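(* For sequences of irreducible discrete-time Markov chains $X^{(n)}$ on finite state spaces $\mathcal X^{(n)}$ with reference pairs $(x_0^{(n)},G^{(n)})$, the following implications hold, for every $\zeta\in(0,1)$: $$Hp.A\;\Longrightarrow\;Hp.G^{LT}\;\Longrightarrow\;Hp.G^{E}\;\Longleftrightarrow\;Hp.G^{\zeta}\;\Longleftrightarrow\;Hp.B .$$ Furthermore, the missing implications are false: there exist such sequences of chains and reference pairs satisfying $Hp.G^{LT}$ but not $Hp.A$, and there exist such sequences satisfying $Hp.G^{E}$ (equivalently $Hp.B$) but not $Hp.G^{LT}$.
   Context: $X^{(n),x}=(X^{(n),x}_t)_{t\in\mathbb N}$ is the $n$-th chain started at $x$. For $F\subset\mathcal X^{(n)}$ let $\tau^{(n),x}_F=\inf\{t\ge0:X^{(n),x}_t\in F\}$ and $\widetilde\tau^{(n),x}_F=\min\{t>0:X^{(n),x}_t\in F\}$ (for a point $y$, the subscript $y$ means $\{y\}$). A reference pair consists of $x_0^{(n)}\in\mathcal X^{(n)}$ and a nonempty $G^{(n)}\subset\mathcal X^{(n)}$ with $x_0^{(n)}\notin G^{(n)}$; $\{x_0^{(n)},G^{(n)}\}$ denotes $\{x_0^{(n)}\}\cup G^{(n)}$, and it is assumed that $\mathcal X^{(n)}\setminus\{x_0^{(n)},G^{(n)}\}\neq\emptyset$. The local time at $x$ before reaching $A$, starting at $z$, is $\xi^{(n),z}_A(x)=|\{t<\tau^{(n),z}_A:\ X^{(n),z}_t=x\}|$. For positive sequences, $B_n\prec A_n$ means $B_n/A_n\to0$.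 $Hp.G(T_n)$: $(T_n)$ is a positive sequence with $T_n\to\infty$, and there exist positive sequences $r_n\to0$ and $R_n\prec T_n$ with $\sup_{x\in\mathcal X^{(n)}}\mathbb P\bigl(\tau^{(n),x}_{\{x_0^{(n)},G^{(n)}\}}>R_n\bigr)\le r_n$ for all $n$. The hypotheses are: - $Hp.G^E$: $Hp.G(T_n^E)$ holds with $T_n^E=\mathbb E\bigl(\tau^{(n),x_0^{(n)}}_{G^{(n)}}\bigr)$. - $Hp.G^\zeta$: $Hp.G(T_n^{Q^\zeta})$ holds with $T_n^{Q^\zeta}=\inf\{t:\ \mathbb P(\tau^{(n),x_0^{(n)}}_{G^{(n)}}>t)\le\zeta\}$. - $Hp.G^{LT}$: $Hp.G(T_n^{LT})$ holds with $T_n^{LT}=\mathbb E\bigl(\xi^{(n),x_0^{(n)}}_{G^{(n)}}(x_0^{(n)})\bigr)$. - $Hp.A$: $\lim_{n\to\infty}|\mathcal X^{(n)}|\,\rho_A(n)=0$, where $$\rho_A(n)=\sup_{z\in\mathcal X^{(n)}\setminus\{x_0^{(n)},G^{(n)}\}}\frac{\mathbb P\bigl(\widetilde\tau^{(n),x_0^{(n)}}_{G^{(n)}}<\widetilde\tau^{(n),x_0^{(n)}}_{x_0^{(n)}}\bigr)}{\mathbb P\bigl(\widetilde\tau^{(n),z}_{\{x_0^{(n)},G^{(n)}\}}<\widetilde\tau^{(n),z}_z\bigr)}.$$ - $Hp.B$: $\lim_{n\to\infty}\rho_B(n)=0$, where $$\rho_B(n)=\sup_{z\in\mathcal X^{(n)}\setminus\{x_0^{(n)},G^{(n)}\}}\frac{\mathbb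 E\,\tau^{(n),z}_{\{x_0^{(n)},G^{(n)}\}}}{\mathbb E\,\tau^{(n),x_0^{(n)}}_{G^{(n)}}}.$$ *)

(* Defs.v *)
From HB Require Import structures.
From mathcomp Require Import all_boot all_order all_algebra.
From mathcomp Require Import all_classical all_reals all_analysis.
Set Implicit Arguments.
Unset Strict Implicit.
Unset Printing Implicit Defensive.
Import Order.TTheory GRing.Theory Num.Theory.
Import numFieldNormedType.Exports.
Local Open Scope classical_set_scope.
Local Open Scope ring_scope.

(* A time-homogeneous discrete-time Markov chain on a finite state space:
   [mc_path x t] is the position at time t of the chain started at x. The chains
   started at the various states live on one probability space, but nothing is
   assumed about their joint law. [mc_markov] is the Markov property multiplied
   out by the probability of the past, so that it is also meaningful for pasts
   of probability zero. *)
Record markov_chain (R : realType) := MarkovChain {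
  mc_state :> finType ;
  mc_trans : mc_state -> mc_state -> R ;
  mc_trans_ge0 : forall x y, 0 <= mc_trans x y ;
  mc_trans_sum1 : forall x, \sum_y mc_trans x y = 1 ;
  mc_disp : measure_display ;
  mc_Omega : measurableType mc_disp ;
  mc_P : probability mc_Omega R ;
  mc_path : mc_state -> nat -> mc_Omega -> mc_state ;
  mc_path_measurable : forall x t y, measurable (mc_path x t @^-1` [set y]) ;
  mc_start : forall x, mc_P [set w | mc_path x 0 w = x] = 1%E ;
  mc_markov : forall x t (s : nat -> mc_state),
    mc_P [set w | forall i, (i <= t.+1)%N -> mc_path x i w = s i] =
    (mc_P [set w | forall i, (i <= t)%N -> mc_path x i w = s i] *
      (mc_trans (s t) (s t.+1))%:E)%E }.

Section Chain.
Variables (R : realType) (C : markov_chain R).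
Implicit Types (x y z : C) (F G : {set C}).

Fixpoint trans_iter (t : nat) x y : R :=
  if t is t'.+1 then \sum_z mc_trans x z * trans_iter t' z y else (x == y)%:R.

Definition irreducible : Prop := forall x y, exists t, 0 < trans_iter t x y.

(* Both times are +oo when the set is never reached. *)
Definition tau x F (w : mc_Omega C) : \bar R :=
  ereal_inf [set t%:R%:E | t in [set t : nat | mc_path x t w \in F]].

Definition tau_plus x F (w : mc_Omega C) : \bar R :=
  ereal_inf
    [set t%:R%:E | t in [set t : nat | (0 < t)%N /\ mc_path x t w \in F]].

Definition local_time z F x (w : mc_Omega C) : \bar R :=
  counting [set t : nat | (t%:R%:E < tau z F w)%E /\ mc_path z t w = x].

Definition Pr (A : set (mc_Omega C)) : R := fine (mc_P C A).

(* Used only for nonnegative variables whose expectation is finite for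
   irreducible chains, so that [fine] loses nothing. *)
Definition Ex (f : mc_Omega C -> \bar R) : R := fine (\int[mc_P C]_w f w)%E.

Definition reference_pair x0 G : Prop :=
  [/\ G != finset.set0, x0 \notin G & ~: (x0 |: G) != finset.set0].

Definition T_E x0 G : R := Ex (tau x0 G).

Definition T_Q (zeta : R) x0 G : R :=
  inf [set t : R | Pr [set w | (t%:E < tau x0 G w)%E] <= zeta].

Definition T_LT x0 G : R := Ex (local_time x0 G x0).

Definition rho_A x0 G : R :=
  sup [set Pr [set w | (tau_plus x0 G w < tau_plus x0 [set x0]%SET w)%E] /
           Pr [set w | (tau_plus z (x0 |: G) w < tau_plus z [set z]%SET w)%E]
      | z in [set z | z \notin x0 |: G]].

Definition rho_B x0 G : R :=
  sup [set Ex (tau z (x0 |: G)) / Ex (tau x0 G)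
      | z in [set z | z \notin x0 |: G]].

End Chain.

Definition prec (R : realType) (B A : nat -> R) : Prop :=
  (fun n => B n / A n) @ \oo --> (0 : R).

Section Hypotheses.
Variables (R : realType) (X : nat -> markov_chain R).
Variables (x0 : forall n, X n) (G : forall n, {set X n}).

Definition HpG (T : nat -> R) : Prop :=
  (forall n, 0 < T n) /\ T @ \oo --> +oo /\
  exists r Rn : nat -> R,
    [/\ forall n, 0 < r n, r @ \oo --> (0 : R), forall n, 0 < Rn n, prec Rn T
      & forall n,
        sup [set Pr [set w | ((Rn n)%:E < tau x (x0 n |: G n)%SET w)%E]
            | x in [set: X n]] <= r n].

Definition HpG_E : Prop := HpG (fun n => T_E (x0 n) (G n)).

Definition HpG_zeta (zeta : R) : Prop :=
  HpG (fun n => T_Q zeta (x0 n) (G n)).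

Definition HpG_LT : Prop := HpG (fun n => T_LT (x0 n) (G n)).

Definition HpA : Prop :=
  (fun n => #|X n|%:R * rho_A (x0 n) (G n)) @ \oo --> (0 : R).

Definition HpB : Prop :=
  (fun n => rho_B (x0 n) (G n)) @ \oo --> (0 : R).

End Hypotheses.

(* Main.v *)
Require Import Defs.
From HB Require Import structures.
From mathcomp Require Import all_boot all_order all_algebra.
From mathcomp Require Import all_classical all_reals all_analysis.
From mathcomp Require Import ring lra measurable_realfun.
Set Implicit Arguments.
Unset Strict Implicit.
Unset Printing Implicit Defensive.
Import Order.TTheory GRing.Theory Num.Theory.
Import numFieldNormedType.Exports.
Local Open Scope classical_set_scope.
Local Open Scope ring_scope.

(** Write [a] for the largest mean time to enter the reference pair
    [x0 |: G], over all starting states. The key point ([HpG_iff]) is that, for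
    positive [T], [HpG T] holds exactly when [a n / T n] tends to 0: uniform
    tail bounds on the entrance time bound its mean through a geometric series
    of blocks ([psum_surv_bound]), and Markov's inequality goes back. The whole
    theorem becomes a comparison of the reference times [T_E], [T_Q], [T_LT]
    with each other and with [a], chain by chain:
    - [rho_B] is exactly [a / T_E] ([rho_BE]);
    - [T_LT <= T_E], a local time being shorter than the time elapsed;
    - [zeta * T_Q <= T_E] by Markov's inequality, and conversely [T_E] is
      bounded by a multiple of [T_Q + a] ([T_E_le_T_Q]), since from any state
      the chain first enters the reference pair and then, if at [x0], needs
      about one quantile more;
    - [a <= #|C| * rho_A * T_LT] ([max_entry_le_rho_A]): an entrance time is the
      sum over the states of the local times before entrance, and the mean
      local time at a state is the inverse of its escape probability
      ([Pr_escape]).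

    These comparisons concern the matrix of the chain killed on a set [F], whose
    powers [taboo] give survival probabilities and whose Green function gives
    mean hitting and local times. The law of finite trajectories
    ([trajectory_law]) connects it with the given random paths.

    The missing implications fail on two explicit families, for which the
    first-step equations can be solved by hand: in [star] entrances take one
    step, but there are as many states as there are visits to [x0]; in [trap]
    the visits to [x0] are separated by excursions so long that a visit count
    no longer measures time. To produce them as random processes, [chain_of]
    realises any stochastic matrix on the unit interval with Lebesgue measure,
    by nested subdivision. *)

(** * Limits and finite suprema *)

Section Limits.
Variable R : realType.

Lemma cvg_sum_fin (I : finType) (u : I -> nat -> R) (l : I -> R) :
  (forall i, u i @ \oo --> l i) -> (fun N => \sum_i u i N) @ \oo --> \sum_i l i.
Proof.
move=> ul; apply: cvg_big => //.
exact: add_continuous.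
Qed.

Lemma squeeze0 (u v : nat -> R) (K : R) : (\forall n \near \oo, 0 <= u n <= K * v n) ->
  v @ \oo --> (0 : R) -> u @ \oo --> (0 : R).
Proof.
move=> uv v0; apply: (squeeze_cvgr uv); first exact: cvg_cst.
by rewrite -[X in _ --> X](mulr0 K); apply: cvgMl_tmp.
Qed.

End Limits.

Section FiniteSup.
Variables (R : realType) (T : finType).

Lemma le_sup_fin (P : set T) (f : T -> R) z : P z -> f z <= sup [set f z | z in P].
Proof.
move=> Pz; apply: ub_le_sup; last by exists z.
by exists (\big[Num.max/f z]_y f y) => _ [y _ <-]; exact: le_bigmax.
Qed.

Lemma sup_fin_le (P : set T) (f : T -> R) (K : R) : P !=set0 ->
  (forall z, P z -> f z <= K) -> sup [set f z | z in P] <= K.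
Proof.
move=> [z Pz] fK; apply: ge_sup; first by exists (f z), z.
by move=> _ [y Py <-]; exact: fK.
Qed.

End FiniteSup.

(** * The chain killed on a set *)

Section Taboo.
Variables (R : realType) (C : markov_chain R).
Implicit Types (x y z : C) (F G : {set C}) (f : C -> R) (t : nat).

Lemma mean_le (f g : C -> R) x :
  (forall y, f y <= g y) ->
  \sum_y mc_trans x y * f y <= \sum_y mc_trans x y * g y.
Proof. by move=> fg; apply: ler_sum => y _; rewrite ler_wpM2l ?mc_trans_ge0. Qed.

Lemma mean_cst (c : R) x : \sum_y mc_trans x y * c = c.
Proof. by rewrite -mulr_suml mc_trans_sum1 mul1r. Qed.

Lemma mean_ge0 f x : (forall y, 0 <= f y) -> 0 <= \sum_y mc_trans x y * f y.
Proof. by move=> f0; apply: sumr_ge0 => y _; rewrite mulr_ge0 ?mc_trans_ge0. Qed.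

(** The value of [taboo F f t x] is the expectation of [f] at time [t] for the
    chain started at [x] and killed on entering [F], time 0 included: the
    [t]-th power of the transition matrix restricted to the complement of [F],
    applied to [f]. *)
Fixpoint taboo F f t x : R :=
  if x \in F then 0
  else if t is t'.+1 then \sum_y mc_trans x y * taboo F f t' y else f x.

Definition surv F := taboo F (fun=> 1).

Definition psum F f N x : R := \sum_(t < N) taboo F f t x.

(** The Green operator of the killed chain: for [f = 1] it gives the mean time
    to reach [F], for [f] the indicator of a state the mean local time there. *)
Definition green F f x : R := limn (fun N => psum F f N x).

Lemma tabooF F f t x : x \in F -> taboo F f t x = 0.
Proof. by case: t => [|t] /= ->. Qed.

Lemma taboo0 F f x : taboo F f 0 x = if x \in F then 0 else f x.
Proof. by []. Qed.

Lemma tabooS F f t x : x \notin F ->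
  taboo F f t.+1 x = \sum_y mc_trans x y * taboo F f t y.
Proof. by move=> /negbTE /= ->. Qed.

Lemma taboo_ge0 F f t x : (forall y, 0 <= f y) -> 0 <= taboo F f t x.
Proof.
move=> f0; elim: t x => [|t IH] x /=; case: ifP => // _.
exact: mean_ge0.
Qed.

Lemma taboo_le F f (g : C -> R) t x : (forall y, f y <= g y) ->
  taboo F f t x <= taboo F g t x.
Proof.
move=> fg; elim: t x => [|t IH] x /=; case: ifP => // _.
exact: mean_le.
Qed.

Lemma taboo_cst F (c : R) t x : taboo F (fun=> c) t x = c * surv F t x.
Proof.
elim: t x => [|t IH] x; rewrite /surv /=; case: ifP => _; rewrite ?mulr0 ?mulr1//.
rewrite mulr_sumr; apply: eq_bigr => y _; by rewrite IH mulrCA.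
Qed.

Lemma taboo_sum F (I : finType) (f : I -> C -> R) t x :
  taboo F (fun y => \sum_i f i y) t x = \sum_i taboo F (f i) t x.
Proof.
elim: t x => [|t IH] x /=; case: ifP => _ //; try by rewrite big1.
by rewrite exchange_big /=; apply: eq_bigr => y _; rewrite IH mulr_sumr.
Qed.

Lemma taboo_add F f s t x : taboo F f (s + t) x = taboo F (taboo F f t) s x.
Proof.
elim: s x => [|s IH] x /=; case: ifP => //; first by move=> xF; rewrite tabooF.
by move=> _; apply: eq_bigr => y _; rewrite IH.
Qed.

Lemma surv_ge0 F t x : 0 <= surv F t x.
Proof. exact: taboo_ge0. Qed.

Lemma surv_le1 F t x : surv F t x <= 1.
Proof.
elim: t x => [|t IH] x; rewrite /surv /=; case: ifP => _ //.
by apply: le_trans (mean_le x IH) _; rewrite mean_cst.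
Qed.

Lemma taboo_le_surv F f (c : R) t x : (forall y, f y <= c) ->
  taboo F f t x <= c * surv F t x.
Proof. by move=> fc; rewrite -taboo_cst; exact: taboo_le. Qed.

Lemma surv_decreasing F s t x : (s <= t)%N -> surv F t x <= surv F s x.
Proof.
move=> /subnKC <-; rewrite /surv taboo_add; apply: taboo_le => y.
exact: surv_le1.
Qed.

(** To avoid [G] during [s + t] steps, either the chain avoids [x0 |: G] during
    the first [s] steps, or it visits [x0] within them and then still has to
    avoid [G] for [t] steps, now starting from [x0]. *)
Lemma surv_split x0 G s t x :
  surv G (s + t) x <= surv (x0 |: G) s x + surv G t x0.
Proof.
elim: s x => [|s IH] x.
  rewrite add0n; have [->|xx0] := eqVneq x x0.
    by rewrite lerDr surv_ge0.
  have [xG|xG] := boolP (x \in G).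
    by rewrite /surv (tabooF _ _ xG) addr_ge0 ?surv_ge0.
  rewrite /surv taboo0 in_setU1 (negbTE xx0) (negbTE xG) /=.
  by apply: le_trans (surv_le1 _ _ _) _; rewrite lerDl surv_ge0.
have [->|xx0] := eqVneq x x0.
  apply: (@le_trans _ _ (surv G t x0)); first by rewrite surv_decreasing// leq_addl.
  by rewrite lerDr surv_ge0.
have [xG|xG] := boolP (x \in G).
  by rewrite /surv (tabooF _ _ xG) addr_ge0 ?surv_ge0.
rewrite addSn /surv !tabooS ?in_setU1 ?(negbTE xx0)//.
rewrite -[X in _ + X](mean_cst _ x) -big_split /=.
apply: ler_sum => y _; rewrite -mulrDr ler_wpM2l ?mc_trans_ge0//; exact: IH.
Qed.

Lemma psumS F f N x :
  psum F f N.+1 x =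
  if x \in F then 0 else f x + \sum_y mc_trans x y * psum F f N y.
Proof.
rewrite /psum big_ord_recl; case: ifPn => xF.
  by rewrite tabooF// big1 ?addr0// => i _; rewrite tabooF.
rewrite taboo0 (negbTE xF); congr (_ + _).
under [RHS]eq_bigr do rewrite mulr_sumr.
rewrite exchange_big /=; apply: eq_bigr => i _.
exact: tabooS.
Qed.

Lemma psum_nd F f x : (forall y, 0 <= f y) ->
  nondecreasing_seq (fun N => psum F f N x).
Proof.
move=> f0; apply/nondecreasing_seqP => N.
by rewrite /psum big_ord_recr/= lerDl taboo_ge0.
Qed.

(** Cutting time into blocks of length [m.+1], each block is survived with
    probability at most [q], so the expected number of steps is dominated by a
    geometric series of blocks. Summing the first [k] blocks by induction on
    [k] gives that bound without any power of [q], because [m.+1 / (1 - q)] is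
    the fixed point of [S |-> m.+1 + q * S]. *)
Lemma psum_surv_bound F m (q : R) N x : q < 1 ->
  (forall y, surv F m.+1 y <= q) -> psum F (fun=> 1) N x <= m.+1%:R / (1 - q).
Proof.
move=> q1 sq.
have q0 : 0 <= q by apply: le_trans (sq x); exact: surv_ge0.
have K0 : 0 <= m.+1%:R / (1 - q) by rewrite divr_ge0// subr_ge0 ltW.
have blocks k y : psum F (fun=> 1) (k * m.+1) y <= m.+1%:R / (1 - q).
  elim: k y => [|k IH] y; first by rewrite mul0n /psum big_ord0.
  rewrite mulSn /psum big_split_ord /=.
  have -> : \sum_(i < k * m.+1) taboo F (fun=> 1) (m.+1 + i) y =
            taboo F (psum F (fun=> 1) (k * m.+1)) m.+1 y.
    rewrite [RHS](_ : _ = taboo F (fun z => \sum_(i < k * m.+1) taboo F (fun=> 1) i z) m.+1 y)//.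
    by rewrite taboo_sum; apply: eq_bigr => i _; rewrite taboo_add.
  have H1 : \sum_(i < m.+1) taboo F (fun=> 1) i y <= m.+1%:R.
    rewrite -[X in _ <= X%:R](card_ord m.+1) -sum1_card natr_sum.
    by apply: ler_sum => i _; exact: surv_le1.
  have H2 : taboo F (psum F (fun=> 1) (k * m.+1)) m.+1 y <= m.+1%:R / (1 - q) * q.
    apply: le_trans (taboo_le_surv _ _ _ IH) _.
    by rewrite ler_wpM2l.
  apply: le_trans (lerD H1 H2) _.
  rewrite le_eqVlt; apply/orP; left; apply/eqP.
  by field; rewrite subr_eq0 gt_eqF.
apply: le_trans (blocks N x); apply: psum_nd => //.
by rewrite leq_pmulr.
Qed.

(** Being at [y] at time [t] and avoiding a set that contains [y] up to time
    [t] are disjoint events. *)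
Lemma surv_hit F y t x : y \in F -> surv F t x + trans_iter t x y <= 1.
Proof.
move=> yF; elim: t x => [|t IH] x; rewrite /surv /=.
  have [->|xy] := eqVneq x y; first by rewrite yF add0r.
  by rewrite addr0; case: ifP.
have iter1 : \sum_z mc_trans x z * trans_iter t z y <= 1.
  rewrite -[leRHS](mean_cst _ x); apply: mean_le => z.
  by apply: le_trans (IH z); rewrite lerDr surv_ge0.
case: ifP => _; first by rewrite add0r.
rewrite -big_split /= -[leRHS](mean_cst _ x).
apply: ler_sum => z _; rewrite -mulrDr ler_wpM2l ?mc_trans_ge0//; exact: IH.
Qed.

Hypothesis irr : irreducible C.

(** Irreducibility gives every starting state a positive probability of having
    met [F] by some time; finiteness of the state space makes the time and the
    probability uniform. *)
Lemma surv_contracts F : F != finset.set0 ->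
  exists m (q : R), q < 1 /\ forall x, surv F m.+1 x <= q.
Proof.
move=> /set0Pn[y yF].
have /choice[T hT] : forall x, exists t, surv F t x < 1.
  move=> x; have [t ht] := irr x y; exists t.
  by have := surv_hit t x yF; lra.
pose m := \max_x T x.
have hm x : surv F m.+1 x < 1.
  apply: le_lt_trans (hT x); apply: surv_decreasing.
  by apply: leqW; exact: leq_bigmax.
exists m.
exists (\big[Num.max/0]_x surv F m.+1 x); split.
  by apply/bigmax_ltP; split.
by move=> x; exact: le_bigmax.
Qed.

Lemma psum_bounded F f : F != finset.set0 -> exists K, forall N x, psum F f N x <= K.
Proof.
move=> /surv_contracts[m [q [q1 sq]]].
pose c := \big[Num.max/0]_y f y.
exists (c * (m.+1%:R / (1 - q))) => N x.
have c0 : 0 <= c by exact: bigmax_ge_id.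
have : psum F f N x <= c * psum F (fun=> 1) N x.
  rewrite /psum mulr_sumr; apply: ler_sum => i _.
  by apply: taboo_le_surv => y; exact: le_bigmax.
move=> /le_trans; apply; rewrite ler_wpM2l//.
exact: psum_surv_bound.
Qed.

Lemma taboo_point F y t x : y \in F -> taboo F (fun u => (u == y)%:R) t x = 0.
Proof.
move=> yF; elim: t x => [|t IH] x /=; case: ifPn => // xF.
  by case: eqP xF => // ->; rewrite yF.
by rewrite big1// => u _; rewrite IH mulr0.
Qed.

Section Green.
Variables (F : {set C}) (f : C -> R).
Hypotheses (F0 : F != finset.set0) (f0 : forall y, 0 <= f y).

Lemma psum_cvg x : (fun N => psum F f N x) @ \oo --> green F f x.
Proof.
have [K hK] := psum_bounded f F0.
apply: nondecreasing_is_cvgn; first exact: psum_nd.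
by exists K => _ [N _ <-]; exact: hK.
Qed.

Lemma psum_le_green N x : psum F f N x <= green F f x.
Proof.
apply: nondecreasing_cvgn_le; first exact: psum_nd.
exact: psum_cvg.
Qed.

Lemma green_le (K : R) x : (forall N, psum F f N x <= K) -> green F f x <= K.
Proof.
move=> hK; apply: limr_le; first exact: psum_cvg.
by apply: nearW => N; exact: hK.
Qed.

Lemma green_ge0 x : 0 <= green F f x.
Proof. by apply: le_trans (psum_le_green 0 x); rewrite /psum big_ord0. Qed.

Lemma greenF x : x \in F -> green F f x = 0.
Proof.
move=> xF; apply: cvg_lim => //.
rewrite (_ : (fun N => _) = (fun=> 0)); first exact: cvg_cst.
by apply/funext => N; rewrite /psum big1// => i _; rewrite tabooF.
Qed.

Lemma green_step x : x \notin F ->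
  green F f x = f x + \sum_y mc_trans x y * green F f y.
Proof.
move=> xF; apply: cvg_lim => //.
rewrite -cvg_shiftS /=.
rewrite (_ : (fun n => _) =
  (fun N => f x + \sum_y mc_trans x y * psum F f N y)); last first.
  by apply/funext => N; rewrite psumS (negbTE xF).
apply: cvgD; first exact: cvg_cst.
apply: cvg_sum_fin => y; apply: cvgMl_tmp; exact: psum_cvg.
Qed.

End Green.

Lemma green_sum (F : {set C}) x : F != finset.set0 ->
  green F (fun=> 1) x = \sum_y green F (fun u => (u == y)%:R) x.
Proof.
move=> F0; apply: cvg_lim => //.
rewrite (_ : (fun N => _) =
  (fun N => \sum_y psum F (fun u => (u == y)%:R) N x)); last first.
  apply/funext => N; rewrite /psum exchange_big /=; apply: eq_bigr => i _.
  rewrite -taboo_sum; congr (taboo F _ i x); apply/funext => u.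
  by rewrite (bigD1 u)//= eqxx big1 ?addr0// => y /negbTE; rewrite eq_sym => ->.
by apply: cvg_sum_fin => y; apply: psum_cvg.
Qed.

(** Survival probabilities decrease in time, so [N.+1] times the last one is
    below their sum: this is Markov's inequality for the hitting time of [F]. *)
Lemma surv_markov F N x : F != finset.set0 ->
  N.+1%:R * surv F N x <= green F (fun=> 1) x.
Proof.
move=> F0; apply: le_trans (psum_le_green F0 _ N.+1 x) => //.
rewrite /psum -[N.+1 in X in X <= _]card_ord -sum1_card natr_sum mulr_suml.
apply: ler_sum => i _; rewrite mul1r; apply: surv_decreasing.
by rewrite -ltnS.
Qed.

Lemma surv_cvg0 F x : F != finset.set0 -> (fun t => surv F t x) @ \oo --> (0 : R).
Proof.
move=> F0.
apply: (@squeeze_cvgr _ _ _ _ (fun=> 0) (fun N => harmonic N * green F (fun=> 1) x)).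
- apply: nearW => N; rewrite surv_ge0 /= /harmonic.
  by rewrite mulrC ler_pdivlMr// mulrC surv_markov.
- exact: cvg_cst.
- rewrite -[X in _ --> X](mul0r (green F (fun=> 1) x)).
  by apply: cvgMr_tmp; exact: cvg_harmonic.
Qed.

(** A subharmonic function off [F] is at most its mean at the time when the
    chain enters [F] or [N] steps have elapsed; the second case has vanishing
    probability as [N] grows. *)
Lemma max_principle (F : {set C}) (h : C -> R) (c K : R) x : F != finset.set0 ->
  (forall y, y \in F -> h y <= c) -> (forall y, h y <= c + K) ->
  (forall y, y \notin F -> h y <= \sum_z mc_trans y z * h z) ->
  h x <= c.
Proof.
move=> F0 hF hK hsub.
have step N y : h y <= c + K * surv F N y.
  elim: N y => [|N IH] y.
    rewrite /surv taboo0; case: ifPn => yF; first by rewrite mulr0 addr0 hF.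
    by rewrite mulr1.
  have [yF|yF] := boolP (y \in F); first by rewrite /surv tabooF// mulr0 addr0 hF.
  apply: le_trans (hsub y yF) _; rewrite /surv tabooS// mulr_sumr.
  rewrite -[X in X + _](mean_cst _ y) -big_split /=; apply: ler_sum => z _.
  rewrite mulrCA -mulrDr ler_wpM2l ?mc_trans_ge0//; exact: IH.
have : (fun N => c + K * surv F N x) @ \oo --> c + K * 0.
  apply: cvgD; first exact: cvg_cst.
  by apply: cvgMl_tmp; exact: surv_cvg0.
rewrite mulr0 addr0 => hc.
rewrite -(cvg_lim _ hc)//; apply: limr_ge; first exact: cvgP hc.
by apply: nearW => N; exact: step.
Qed.

(** To spend time at [z] the chain must first get there, so the mean local time
    is largest when it starts at [z]. *)
Lemma green_max F z x : F != finset.set0 -> z \notin F ->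
  green F (fun u => (u == z)%:R) x <= green F (fun u => (u == z)%:R) z.
Proof.
move=> F0 zF; have [K hK] := psum_bounded (fun u => (u == z)%:R) F0.
have g0 y : 0 <= green F (fun u => (u == z)%:R) y by exact: green_ge0.
apply: (@max_principle (z |: F) _ _ K).
- by apply/set0Pn; exists z; rewrite setU11.
- move=> y /setU1P[->//|yF]; by rewrite (greenF _ yF).
- move=> y; apply: (@le_trans _ _ K); last by rewrite lerDr.
  by apply: green_le.
- move=> y; rewrite in_setU1 negb_or => /andP[yz yF].
  by rewrite (green_step F0)// (negbTE yz) add0r.
Qed.

End Taboo.

(** * The law of finite trajectories *)

Section PathLaw.
Variables (R : realType) (C : markov_chain R).
Implicit Types (x y z : C) (F G : {set C}) (t : nat) (B : seq C -> bool).

Definition trajectory x t (w : mc_Omega C) : seq C :=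
  mkseq (fun i => mc_path x i w) t.+1.

Arguments trajectory : simpl never.

(** First-step recursion for the probability that the initial trajectory
    [X_0, ..., X_t] of the chain started at [x] satisfies [B]. Since the chains
    started at different states have no prescribed joint law, first-step
    analysis is done on this function and not on the random trajectories. *)
Fixpoint cyl_prob t B x : R :=
  if t is t'.+1 then \sum_y mc_trans x y * cyl_prob t' (fun s => B (x :: s)) y
  else (B [:: x])%:R.

Lemma eq_cyl_prob t B B' x : (forall s, size s = t.+1 -> B s = B' s) ->
  cyl_prob t B x = cyl_prob t B' x.
Proof.
elim: t B B' x => [|t IH] B B' x BB' /=; first by rewrite BB'.
apply: eq_bigr => y _; congr (_ * _); apply: IH => s ss.
by rewrite BB'//= ss.
Qed.

Lemma measurable_trajectory B x t : measurable [set w | B (trajectory x t w)].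
Proof.
elim: t B => [|t IH] B.
  rewrite (_ : [set w | _] = \bigcup_(y in [set y | B [:: y]])
     (mc_path x 0 @^-1` [set y])).
    by apply: fin_bigcup_measurable => // y _; exact: mc_path_measurable.
  apply/seteqP; split => w /=; first by move=> Bw; exists (mc_path x 0 w).
  by move=> [y /= By e]; rewrite /trajectory /mkseq /= e.
rewrite (_ : [set w | _] = \bigcup_(y in [set: C])
   (mc_path x t.+1 @^-1` [set y] `&` [set w | B (rcons (trajectory x t w) y)])).
  apply: fin_bigcup_measurable => // y _; apply: measurableI.
    exact: mc_path_measurable.
  exact: (IH (fun s => B (rcons s y))).
have E w : trajectory x t.+1 w = rcons (trajectory x t w) (mc_path x t.+1 w).
  by rewrite /trajectory mkseqS.
apply/seteqP; split => w /=; first by rewrite E => Bw; exists (mc_path x t.+1 w).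
by move=> [y _ [/= e]]; rewrite E e.
Qed.

Lemma trajectory_eqP x k (s : nat -> C) w :
  (trajectory x k w == mkseq s k.+1) <-> (forall i, (i <= k)%N -> mc_path x i w = s i).
Proof.
split=> [/eqP e i ik|e].
  have := congr1 (fun u => nth x u i) e.
  by rewrite /trajectory !nth_mkseq.
apply/eqP; apply: (@eq_from_nth _ x); rewrite /trajectory !size_mkseq// => i ik.
by rewrite !nth_mkseq// e.
Qed.

Lemma measure_partition x t (E : set (mc_Omega C)) : measurable E ->
  mc_P C E = (\sum_y mc_P C (E `&` [set w | mc_path x t w = y]))%E.
Proof.
move=> mE.
have {1}-> : E = \bigcup_(y in [set` enum C]) (E `&` [set w | mc_path x t w = y]).
  apply/seteqP; split => w; last by move=> [y _ []].
  by move=> Ew; exists (mc_path x t w) => //=; rewrite mem_enum.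
rewrite measure_fin_bigcup//.
- by rewrite -fsbig_seq ?enum_uniq// big_enum.
- move=> i j _ _ [w [[_ /= <-] [_ /= <-]]] //.
- by move=> y _; apply: measurableI => //; exact: mc_path_measurable.
Qed.

Definition past x k (s : nat -> C) : set (mc_Omega C) :=
  [set w | forall i, (i <= k)%N -> mc_path x i w = s i].

Lemma measurable_past x k s : measurable (past x k s).
Proof.
rewrite (_ : past x k s = [set w | (pred1 (mkseq s k.+1)) (trajectory x k w)]).
  exact: measurable_trajectory.
by apply/seteqP; split => w /= /trajectory_eqP.
Qed.

(** The inductive form of the Markov property: given the past up to time [k],
    the next [t] steps follow the first-step recursion from the current state.
    The induction splits the event according to the state at time [k.+1],
    which becomes part of the past, where the one-step hypothesis applies. *)
Lemma future_law x k t B (s : nat -> C) :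
  mc_P C (past x k s `&` [set w | B (trajectory x (k + t) w)]) =
  (mc_P C (past x k s) * (cyl_prob t (fun u => B (mkseq s k ++ u)) (s k))%:E)%E.
Proof.
elim: t k s => [|t IH] k s.
  rewrite addn0 /= cats1 -mkseqS.
  have E w : past x k s w -> trajectory x k w = mkseq s k.+1.
    by move=> /trajectory_eqP/eqP.
  case Bs: (B (mkseq s k.+1)); last first.
    rewrite mule0 -[RHS](measure0 (mc_P C)); congr (mc_P C _).
    by apply/seteqP; split => w //= [/E ->]; rewrite Bs.
  rewrite mule1; congr (mc_P C _).
  by apply/seteqP; split => w /=; [case|move=> pw; split => //; rewrite E].
rewrite (@measure_partition x k.+1); last first.
  by apply: measurableI; [exact: measurable_past|exact: measurable_trajectory].
(* [s' y] prolongs the past by one step to the state [y] *)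
pose s' y i := if i == k.+1 then y else s i.
have s'k y i : (i <= k)%N -> s' y i = s i by rewrite /s' => ik; rewrite ltn_eqF.
have s'p y : past x k (s' y) = past x k s.
  by apply/seteqP; split => w pw i ik; rewrite pw// s'k.
have s'1 y : s' y k.+1 = y by rewrite /s' eqxx.
have ms y : mkseq (s' y) k.+1 = rcons (mkseq s k) (s k).
  rewrite -mkseqS; apply: (@eq_from_nth _ y); rewrite !size_mkseq// => i ik.
  by rewrite !nth_mkseq// s'k.
under eq_bigr => y _.
  rewrite (_ : _ `&` _ = past x k.+1 (s' y) `&` [set w | B (trajectory x (k.+1 + t) w)]); last first.
    rewrite addSnnS; apply/seteqP; split => w /=.
      move=> [[pw Bw] e]; split => // i.
      rewrite leq_eqVlt => /orP[/eqP ->|ik]; first by rewrite /s' eqxx.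
      by rewrite s'k// pw.
    move=> [pw Bw]; split; last by rewrite pw// /s' eqxx.
    by split => // i ik; rewrite pw ?s'k// (leqW ik).
  rewrite IH mc_markov -/(past x k (s' y)) s'p s'k//.
  rewrite s'1 ms.
  rewrite -muleA -EFinM.
  rewrite (@eq_cyl_prob _ _ (fun u => B (mkseq s k ++ s k :: u))); last first.
    by move=> u _; rewrite cat_rcons.
  over.
rewrite -ge0_sume_distrr.
  by rewrite sumEFin.
move=> y _; rewrite lee_fin mulr_ge0 ?mc_trans_ge0//.
elim: (t) (fun u : seq C => _) (y) => [|t' IH'] b z /=; first by rewrite ler0n.
by apply: sumr_ge0 => u _; rewrite mulr_ge0 ?mc_trans_ge0.
Qed.

Lemma trajectory_law x t B : mc_P C [set w | B (trajectory x t w)] = (cyl_prob t B x)%:E.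
Proof.
have p1 : mc_P C (past x 0 (fun=> x)) = 1%E.
  rewrite -(mc_start x); congr (mc_P C _); apply/seteqP; split => w /=.
    by apply.
  by move=> e [|i].
have := @future_law x 0 t B (fun=> x).
rewrite p1 mul1e => <-; rewrite add0n.
have mp := measurable_past x 0 (fun=> x).
have mB := measurable_trajectory B x t.
rewrite (measureDI _ mB mp) setIC [X in (X + _)%E](_ : _ = 0%E) ?add0e//.
have p0 : mc_P C (~` past x 0 (fun=> x)) = 0%E.
  by rewrite probability_setC// p1 subee.
apply: (subset_measure0 _ _ _ p0) => //.
- exact: measurableD.
- exact: measurableC.
Qed.

End PathLaw.

(** * Hitting times and local times *)

Section HittingTimes.
Variables (R : realType) (C : markov_chain R).
Implicit Types (x y z : C) (F G : {set C}) (t : nat) (w : mc_Omega C).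

Definition avoids F (s : seq C) : bool := all (fun y => y \notin F) s.

Lemma cyl_prob_avoids F (a : pred C) d t x :
  cyl_prob t (fun s => avoids F s && a (last d s)) x = taboo F (fun u => (a u)%:R) t x.
Proof.
elim: t d x => [|t IH] d x /=; first by rewrite andbT; case: ifP.
case: ifP => xF /=.
  apply: big1 => y _; rewrite (_ : cyl_prob _ _ _ = 0) ?mulr0//.
  elim: (t) (y) => [//|t' IH'] y' /=; apply: big1 => z _.
  by rewrite IH' mulr0.
by apply: eq_bigr => y _; rewrite -(IH x).
Qed.

Lemma avoids_trajectoryP x F t w :
  reflect (forall i, (i <= t)%N -> mc_path x i w \notin F) (avoids F (trajectory x t w)).
Proof.
apply: (iffP allP) => [h i it|h _ /mapP[i + ->]].
  by apply: h; apply/mapP; exists i; rewrite // mem_iota.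
by rewrite mem_iota add0n ltnS => it; apply: h.
Qed.

Lemma lt_tau x F (r : R) t w : t%:R <= r < t.+1%:R ->
  (r%:E < tau x F w)%E = avoids F (trajectory x t w).
Proof.
move=> /andP[tr rt]; apply/idP/avoids_trajectoryP => [lt i it|h].
  apply/negP => iF; move: lt; rewrite ltNge => /negP; apply.
  apply: (@le_trans _ _ i%:R%:E).
    by apply: ereal_inf_lbound; exists i.
  by rewrite lee_fin (le_trans _ tr)// ler_nat.
apply: (@lt_le_trans _ _ t.+1%:R%:E); first by rewrite lte_fin.
apply: le_ereal_inf_tmp => _ [i /= iF <-]; rewrite lee_fin ler_nat ltnNge.
by apply/negP => /h; rewrite iF.
Qed.

Lemma lt_tau_nat x F t w :
  (t%:R%:E < tau x F w)%E = avoids F (trajectory x t w).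
Proof. by apply: lt_tau; rewrite lexx ltr_nat ltnS leqnn. Qed.

Lemma mc_P_avoids x F t :
  mc_P C [set w | avoids F (trajectory x t w)] = (surv F t x)%:E.
Proof.
rewrite trajectory_law -[X in X%:E = _](@eq_cyl_prob _ _ _ (fun s => avoids F s && predT (last x s))).
  by rewrite cyl_prob_avoids.
by move=> s _; rewrite andbT.
Qed.

Lemma Pr_lt_tau x F (r : R) : 0 <= r ->
  Pr [set w | (r%:E < tau x F w)%E] = surv F (Num.truncn r) x.
Proof.
move=> r0; rewrite /Pr (_ : [set w | _] = [set w | avoids F (trajectory x (Num.truncn r) w)]).
  by rewrite mc_P_avoids.
by apply/seteqP; split => w /=; rewrite (lt_tau _ _ _ (truncn_itv r0)).
Qed.

(** Counting is a sum of Dirac masses, so the mean number of times [t] at which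
    an event [A t] occurs is the sum of the probabilities of these events. *)
Lemma Ex_counting (A : nat -> set (mc_Omega C)) (a : nat -> R) (l : R) :
  (forall t, measurable (A t)) -> (forall t, mc_P C (A t) = (a t)%:E) ->
  (fun N => \sum_(t < N) a t) @ \oo --> l ->
  Ex (fun w => counting [set t | A t w]) = l.
Proof.
move=> mA Aa al; rewrite /Ex.
under eq_integral do rewrite counting_dirac.
rewrite (_ : (fun w => _) = (fun w => \sum_(t <oo) (\1_(A t) w)%:E)%E); last first.
  by apply/funext => w; apply: eq_eseriesr => t _; rewrite diracE indicE; congr (_%:R%:E);
    apply/idP/idP; rewrite !inE.
rewrite integral_nneseries//; last first.
  by move=> t; apply/measurable_EFinP; exact: measurable_indic.
rewrite (eq_eseriesr (g := fun t => (a t)%:E)); last first.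
  by move=> t _; rewrite integral_indic// setIT; exact: Aa.
rewrite (_ : limn _ = l%:E)//; apply: cvg_lim => //.
rewrite (_ : (fun n => _) = EFin \o (fun N => \sum_(t < N) a t)).
  by apply: cvg_EFin => //; apply: nearW.
by apply/funext => N; rewrite /= big_mkord sumEFin.
Qed.

(** Both the hitting time and the local time thus become instances of
    [Ex_counting]; when [F] is never reached both sides are infinite. *)
Lemma tau_counting x F w :
  tau x F w = counting [set t | (t%:R%:E < tau x F w)%E].
Proof.
have [[n nF]|nh] := pselect (exists n, mc_path x n w \in F); last first.
  have -> : tau x F w = +oo%E.
    rewrite /tau (_ : [set _ | _ in _] = set0) ?ereal_inf0//.
    by apply/seteqP; split => // y [n nF _]; apply: nh; exists n.
  rewrite (_ : [set t | _] = setT).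
    by rewrite /counting asboolF//; exact: infinite_nat.
  by apply/funext => t /=; rewrite ltry propeqE.
have ex : exists n, mc_path x n w \in F by exists n.
case: (ex_minnP ex) => {nF ex}n nF nmin.
have E : tau x F w = n%:R%:E.
  apply/eqP; rewrite eq_le; apply/andP; split.
    by apply: ereal_inf_lbound; exists n.
  by apply: le_ereal_inf_tmp => _ [i /= iF <-]; rewrite lee_fin ler_nat nmin.
rewrite E (_ : [set t | _] = `I_n); last first.
  by apply/seteqP; split => t /=; rewrite lte_fin ltr_nat.
rewrite /counting asboolT; last exact: finite_II.
by rewrite (card_fset_set (card_eqxx _)).
Qed.

Hypothesis irr : irreducible C.

Lemma Ex_tau x F : F != finset.set0 -> Ex (tau x F) = green F (fun=> 1) x.
Proof.
move=> F0; rewrite (_ : tau x F = fun w => counting [set t | (t%:R%:E < tau x F w)%E]).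
  apply: (@Ex_counting (fun t => [set w | (t%:R%:E < tau x F w)%E]) (fun t => surv F t x)).
  - move=> t; rewrite (_ : [set w | _] = [set w | avoids F (trajectory x t w)]).
      exact: measurable_trajectory.
    by apply/seteqP; split => w /=; rewrite lt_tau_nat.
  - move=> t; rewrite -mc_P_avoids; congr (mc_P C _).
    by apply/seteqP; split => w /=; rewrite lt_tau_nat.
  - exact: psum_cvg.
by apply/funext => w; exact: tau_counting.
Qed.

Lemma last_trajectory d x t w : last d (trajectory x t w) = mc_path x t w.
Proof. by rewrite /trajectory mkseqS last_rcons. Qed.

Lemma Ex_local_time x F y : F != finset.set0 ->
  Ex (local_time x F y) = green F (fun u => (u == y)%:R) x.
Proof.
move=> F0; pose B (s : seq C) := avoids F s && (last x s == y).
pose A t := [set w | avoids F (trajectory x t w) && (mc_path x t w == y)].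
have AE t : A t = [set w | B (trajectory x t w)].
  by apply: eq_set => w; rewrite /B last_trajectory.
rewrite (_ : local_time x F y = fun w => counting [set t | A t w]).
  apply: (@Ex_counting A (fun t => taboo F (fun u => (u == y)%:R) t x)).
  - by move=> t; rewrite AE; exact: measurable_trajectory.
  - by move=> t; rewrite AE trajectory_law (cyl_prob_avoids _ (pred1 y)).
  - exact: psum_cvg.
apply/funext => w; rewrite /local_time; congr counting.
apply/seteqP; split => t; rewrite /A /mkset lt_tau_nat.
  by move=> [-> ->] /=.
by move=> /andP[-> /eqP].
Qed.

End HittingTimes.

(** * Escape probabilities *)

Section Escape.
Variables (R : realType) (C : markov_chain R).
Hypothesis irr : irreducible C.
Variables (F : {set C}) (z : C).
Hypotheses (F0 : F != finset.set0) (zF : z \notin F).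
Implicit Types (x y : C) (t : nat) (w : mc_Omega C).

(** On a trajectory with its initial state removed, [hits_first] is the event
    that [F] is reached before the chain returns to [z]. *)
Fixpoint hits_first (s : seq C) : bool :=
  if s is y :: s' then (y \in F) || (y != z) && hits_first s' else false.

Lemma hits_firstP (d : C) s :
  reflect (exists2 j, (j < size s)%N &
     nth d s j \in F /\ forall i, (i <= j)%N -> nth d s i != z)
    (hits_first s).
Proof.
have Fz y : y \in F -> y != z by move=> yF; apply: contraNneq zF => <-.
elim: s => [|y s IH] /=; first by constructor; case.
apply: (iffP orP) => [[yF|/andP[yz /IH[j js [jF jz]]]]|[[|j] js [/= jF jz]]].
- by exists 0%N => //; split => // -[|//] _; exact: Fz.
- by exists j.+1 => //; split => // -[|i] //= ij; exact: jz.
- by left.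
- right; rewrite (jz 0%N)//=; apply/IH; exists j => //; split => // i ij.
  exact: (jz i.+1).
Qed.

Definition reached (N : nat) : set (mc_Omega C) :=
  [set w | hits_first (behead (trajectory z N w))].

Lemma reachedP N w : reached N w <-> exists n, [/\ (0 < n <= N)%N,
  mc_path z n w \in F & forall i, (0 < i <= n)%N -> mc_path z i w != z].
Proof.
have E j : (j < N)%N -> nth z (behead (trajectory z N w)) j = mc_path z j.+1 w.
  by move=> jN; rewrite nth_behead nth_mkseq.
have S : size (behead (trajectory z N w)) = N by rewrite size_behead size_mkseq.
rewrite /reached /=; split => [/(hits_firstP z)[j]|[[|n] [//= nN nF nz]]].
  rewrite S => jN [jF jz]; exists j.+1; split; rewrite -?E// => -[//|i] /= ij.
  by rewrite -E ?jz//; exact: leq_ltn_trans jN.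
apply/(hits_firstP z); exists n; first by rewrite S.
rewrite E//; split => // i i_n; rewrite E ?nz//.
exact: leq_ltn_trans nN.
Qed.

Lemma escape_bigcup :
  [set w | (tau_plus z F w < tau_plus z [set z]%SET w)%E] = \bigcup_N reached N.
Proof.
apply/seteqP; split => w /=.
  move=> /ereal_inf_lt[_ [n [n0 nF] <-] lt].
  exists n => //; apply/reachedP; exists n; split => //; first by rewrite n0 /=.
  move=> i /andP[i0 i_n]; apply/negP => /eqP iz.
  move: lt; rewrite ltNge => /negP; apply.
  apply: (@le_trans _ _ i%:R%:E); last by rewrite lee_fin ler_nat.
  by apply: ereal_inf_lbound; exists i => //; split => //; rewrite finset.in_set1 iz.
move=> [N _ /reachedP[n [/andP[n0 _] nF nz]]].
apply: (@le_lt_trans _ _ n%:R%:E).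
  by apply: ereal_inf_lbound; exists n.
apply: (@lt_le_trans _ _ n.+1%:R%:E); first by rewrite lte_fin ltr_nat.
apply: le_ereal_inf_tmp => _ [i /= [i0 iz] <-]; rewrite lee_fin ler_nat ltnNge.
apply/negP => i_n; have := nz i; rewrite i0 i_n => /(_ erefl).
by rewrite finset.in_set1 in iz; rewrite iz.
Qed.

Fixpoint hit_prob N y : R :=
  if y \in F then 1 else if y == z then 0
  else if N is N'.+1 then \sum_y' mc_trans y y' * hit_prob N' y' else 0.

Lemma cyl_prob_cst (b : bool) t x : cyl_prob t (fun _ : seq C => b) x = b%:R.
Proof.
elim: t x => [//|t IH] x /=.
under eq_bigr => y _ do rewrite IH.
by rewrite mean_cst.
Qed.

Lemma cyl_prob_hits_first N y : cyl_prob N hits_first y = hit_prob N y.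
Proof.
elim: N y => [|N IH] y /=; first by rewrite andbF orbF; case: ifP => //; case: ifP.
case: ifPn => yF /=.
  by under eq_bigr => y' _ do rewrite cyl_prob_cst; rewrite mean_cst.
case: eqP => yz /=.
  by under eq_bigr => y' _ do rewrite cyl_prob_cst; rewrite mean_cst.
by apply: eq_bigr => y' _; rewrite -IH.
Qed.

Lemma mc_P_reached N :
  mc_P C (reached N.+1) = (\sum_y mc_trans z y * hit_prob N y)%:E.
Proof.
rewrite (trajectory_law z N.+1 (fun s => hits_first (behead s))) /=.
by congr _%:E; apply: eq_bigr => y _; rewrite -cyl_prob_hits_first.
Qed.

Local Notation h := (green F (fun u => (u == z)%:R)).

Lemma green_return_ge1 : 1 <= h z.
Proof.
rewrite (green_step irr F0 (fun v => ler0n R (v == z)) zF).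
rewrite eqxx lerDl; apply: mean_ge0 => y; apply: (green_ge0 irr F0) => u.
exact: ler0n.
Qed.

Let u y := 1 - h y / h z.

Let D := z |: F.

(** The function [u] equals 1 on [F] and 0 at [z] and is harmonic elsewhere, by
    the first-step equation of the Green function [h]. So [u] is the
    probability of reaching [F] before [z], and it differs from the
    probability of doing so within [N] steps by at most the probability that
    neither has been reached after [N] steps. *)
Lemma hit_prob_bounds N y : hit_prob N y <= u y <= hit_prob N y + surv D N y.
Proof.
have hz1 := green_return_ge1; have hz0 : 0 < h z by apply: lt_le_trans hz1.
have i0 v : 0 <= (v == z)%:R :> R by exact: ler0n.
have uF v : v \in F -> u v = 1.
  by move=> vF; rewrite /u (greenF _ vF) mul0r subr0.
have uz : u z = 0 by rewrite /u divff ?subrr// gt_eqF.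
have u01 v : 0 <= u v <= 1.
  rewrite /u subr_ge0 ler_pdivrMr// mul1r (green_max irr)//=.
  by rewrite lerBlDr lerDl divr_ge0 ?(ltW hz0)// (green_ge0 irr).
have uharm v : v \notin F -> v != z -> u v = \sum_y mc_trans v y * u y.
  move=> vF vz; rewrite /u (green_step irr F0)// (negbTE vz) add0r.
  under [RHS]eq_bigr do rewrite mulrBr mulr1 mulrA.
  by rewrite sumrB mc_trans_sum1 mulr_suml.
elim: N y => [|N IH] y.
  rewrite /surv taboo0 /= in_setU1.
  have [yF|yF] := boolP (y \in F); first by rewrite uF// orbT addr0 lexx.
  have [->|yz] := eqVneq y z; first by rewrite uz addr0 lexx.
  by rewrite add0r u01.
have [yF|yF] := boolP (y \in F).
  by rewrite /= yF uF// lexx lerDl surv_ge0.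
have [->|yz] := eqVneq y z.
  by rewrite /= (negbTE zF) eqxx uz lexx add0r surv_ge0.
rewrite /surv tabooS; last by rewrite in_setU1 negb_or yz.
rewrite /= (negbTE yF) (negbTE yz) uharm// -big_split /=.
apply/andP; split; first by apply: mean_le => v; case/andP: (IH v).
apply: ler_sum => v _; rewrite -mulrDr ler_wpM2l ?mc_trans_ge0//.
by case/andP: (IH v).
Qed.

Lemma hit_prob_cvg y : hit_prob ^~ y @ \oo --> u y.
Proof.
apply: (@squeeze_cvgr _ _ _ _ (fun N => u y - surv D N y) (fun=> u y)).
- apply: nearW => N; have /andP[l1 l2] := hit_prob_bounds N y.
  by rewrite l1 lerBlDr l2.
- rewrite -[X in _ --> X]subr0; apply: cvgB; first exact: cvg_cst.
  apply: surv_cvg0 => //; apply/set0Pn; exists z; exact: setU11.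
- exact: cvg_cst.
Qed.

(** The number of visits to [z] before [F] is geometric with the escape
    probability as parameter, hence the two are inverse to each other. Here
    this is read off the first-step equation at [z], where the mean of [u]
    after one step is [1 - (h z - 1) / h z]. *)
Lemma Pr_escape :
  Pr [set w | (tau_plus z F w < tau_plus z [set z]%SET w)%E] = (h z)^-1.
Proof.
have hz1 := green_return_ge1; have hz0 : 0 < h z by apply: lt_le_trans hz1.
have mr N : measurable (reached N).
  exact: (measurable_trajectory (fun s => hits_first (behead s))).
rewrite escape_bigcup /Pr.
have : mc_P C \o reached @ \oo --> mc_P C (\bigcup_N reached N).
  apply: nondecreasing_cvg_mu => //; first exact: bigcup_measurable.
  move=> M N MN; apply/subsetPset => w /reachedP[n [/andP[n0 nM] nF nz]].
  by apply/reachedP; exists n; rewrite n0 (leq_trans nM MN).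
rewrite -cvg_shiftS.
rewrite (_ : [sequence _]_n =
  EFin \o (fun N => \sum_y mc_trans z y * hit_prob N y)); last first.
  by apply/funext => N /=; rewrite mc_P_reached.
have : (EFin \o (fun N => \sum_y mc_trans z y * hit_prob N y)) @ \oo -->
       (\sum_y mc_trans z y * u y)%:E.
  apply: cvg_EFin; first exact: nearW.
  by apply: cvg_sum_fin => y; apply: cvgMl_tmp; exact: hit_prob_cvg.
move=> /(cvg_lim (@ereal_hausdorff R)) lim_u /(cvg_lim (@ereal_hausdorff R)).
rewrite lim_u => <- /=.
rewrite /u; under eq_bigr do rewrite mulrBr mulr1 mulrA.
rewrite sumrB mc_trans_sum1 -mulr_suml.
have := green_step irr F0 (fun v => ler0n R (v == z)) zF.
rewrite eqxx mulr1n => E.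
have -> : \sum_y mc_trans z y * h y = h z - 1 by rewrite E addrC addKr.
by field; rewrite gt_eqF.
Qed.

End Escape.

(** * Comparison of the reference times *)

Section ReferencePair.
Variables (R : realType) (C : markov_chain R) (x0 : C) (G : {set C}).
Hypotheses (irr : irreducible C) (ref : reference_pair x0 G).
Implicit Types (x y z : C) (t : nat).

Local Notation D := (x0 |: G).

(** The worst mean time to reach the reference pair; it is the only feature of
    the chain, besides the reference time [T], that [HpG T] depends on. *)
Definition max_entry : R := \big[Num.max/0]_x green D (fun=> 1) x.

Let G0 : G != finset.set0. Proof. by case: ref. Qed.
Let x0G : x0 \notin G. Proof. by case: ref. Qed.
Let D0 : D != finset.set0.
Proof. by apply/set0Pn; exists x0; exact: setU11. Qed.

Lemma other_state : exists z, z \notin D.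
Proof. by case: ref => _ _ /set0Pn[z]; rewrite finset.in_setC; exists z. Qed.

Lemma green1_ge1 F x : F != finset.set0 -> x \notin F -> 1 <= green F (fun=> 1) x.
Proof.
move=> F0 xF; rewrite (green_step irr F0 _ xF)// lerDl.
by apply: mean_ge0 => y; exact: (green_ge0 irr F0).
Qed.

Lemma green_le_max x : green D (fun=> 1) x <= max_entry.
Proof. exact: le_bigmax. Qed.

Lemma max_entry_le (K : R) : 0 <= K ->
  (forall x, x \notin D -> green D (fun=> 1) x <= K) -> max_entry <= K.
Proof.
move=> K0 h; apply/bigmax_leP; split => // x _.
by have [xD|/h//] := boolP (x \in D); rewrite (greenF _ xD).
Qed.

Lemma max_entry_ge1 : 1 <= max_entry.
Proof.
have [z zD] := other_state.
by apply: le_trans (green_le_max z); exact: green1_ge1.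
Qed.

Lemma T_E_green : T_E x0 G = green G (fun=> 1) x0.
Proof. exact: Ex_tau. Qed.

Lemma T_LT_green : T_LT x0 G = green G (fun u => (u == x0)%:R) x0.
Proof. exact: Ex_local_time. Qed.

Lemma T_E_ge1 : 1 <= T_E x0 G.
Proof. by rewrite T_E_green green1_ge1. Qed.

Lemma T_LT_ge1 : 1 <= T_LT x0 G.
Proof. by rewrite T_LT_green (green_return_ge1 irr). Qed.

Lemma T_LT_le_T_E : T_LT x0 G <= T_E x0 G.
Proof.
rewrite T_LT_green T_E_green; apply: (green_le irr G0) => [y|N].
  exact: ler0n.
apply: le_trans (psum_le_green irr G0 _ N x0) => //.
by apply: ler_sum => i _; apply: taboo_le => y; case: eqP.
Qed.

Lemma rho_BE : rho_B x0 G = max_entry / T_E x0 G.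
Proof.
have T0 : 0 < T_E x0 G by apply: lt_le_trans T_E_ge1.
have E z : Ex (tau z D) = green D (fun=> 1) z by exact: Ex_tau.
apply/eqP; rewrite eq_le; apply/andP; split.
  apply: sup_fin_le => [|z zD]; first by have [z] := other_state; exists z.
  by rewrite E ler_pM2r ?invr_gt0// green_le_max.
have le z : z \notin D -> green D (fun=> 1) z / T_E x0 G <= rho_B x0 G.
  move=> zD; rewrite -E.
  exact: (@le_sup_fin _ _ [set z | z \notin D] (fun z => Ex (tau z D) / Ex (tau x0 G))).
rewrite ler_pdivrMr//; apply: max_entry_le => [|z /le].
  have [z /le h] := other_state.
  rewrite mulr_ge0 ?(ltW T0)//; apply: le_trans h.
  by rewrite divr_ge0 ?(ltW T0)// (green_ge0 irr D0).
by rewrite ler_pdivrMr.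
Qed.

(** The time before entering [x0 |: G] is the sum over the states [z] outside
    it of the local times at [z], each of which is at most its value for the
    chain started at [z]. By [Pr_escape] this value is the inverse of the
    denominator in [rho_A], and [T_LT] is the inverse of the numerator. *)
Lemma max_entry_le_rho_A : max_entry <= #|C|%:R * rho_A x0 G * T_LT x0 G.
Proof.
pose g z := green D (fun u => (u == z)%:R) z.
have T0 : 0 < T_LT x0 G by apply: lt_le_trans T_LT_ge1.
have rhoE z : z \notin D -> g z <= rho_A x0 G * T_LT x0 G.
  move=> zD; rewrite -ler_pdivrMr//.
  have := @le_sup_fin _ _ [set z | z \notin D] (fun z =>
    Pr [set w | (tau_plus x0 G w < tau_plus x0 [set x0]%SET w)%E] /
    Pr [set w | (tau_plus z D w < tau_plus z [set z]%SET w)%E]) z zD.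
  by rewrite -/(rho_A x0 G) !Pr_escape// invrK -T_LT_green mulrC.
have rho0 : 0 <= rho_A x0 G * T_LT x0 G.
  have [z zD] := other_state; apply: le_trans (rhoE z zD).
  by apply: (green_ge0 irr D0) => u; exact: ler0n.
apply: max_entry_le => [|x xD]; first by rewrite -mulrA mulr_ge0.
rewrite (green_sum irr _ D0) -mulrA.
rewrite -[#|C|]sum1_card natr_sum mulr_suml; apply: ler_sum => y _.
rewrite mul1r; have [yD|yD] := boolP (y \in D).
  rewrite (_ : green _ _ _ = 0)//; apply: cvg_lim => //.
  rewrite (_ : (fun N => _) = (fun=> 0)); first exact: cvg_cst.
  by apply/funext => N; rewrite /psum big1// => i _; rewrite taboo_point.
by apply: le_trans (rhoE y yD); exact: green_max.
Qed.

(** The denominators in [rho_A] are probabilities, and its numerator is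
    [(T_LT x0 G)^-1]. *)
Lemma inv_T_LT_le_rho_A : (T_LT x0 G)^-1 <= rho_A x0 G.
Proof.
have [z zD] := other_state.
have T0 := lt_le_trans ltr01 T_LT_ge1.
have := @le_sup_fin _ _ [set z | z \notin D] (fun z =>
    Pr [set w | (tau_plus x0 G w < tau_plus x0 [set x0]%SET w)%E] /
    Pr [set w | (tau_plus z D w < tau_plus z [set z]%SET w)%E]) z zD.
apply: le_trans; rewrite !Pr_escape// invrK -T_LT_green//.
by rewrite ler_peMr ?invr_ge0 ?(ltW T0)// (green_return_ge1 irr).
Qed.

Section Quantile.
Variable zeta : R.
Hypothesis zeta01 : 0 < zeta < 1.

(** The hitting time is integer valued, so its quantile is the first integer at
    which the survival probability drops to [zeta]. *)
Lemma T_Q_nat : exists t,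
  [/\ T_Q zeta x0 G = t%:R, (0 < t)%N, surv G t x0 <= zeta &
      forall k, surv G k x0 <= zeta -> (t <= k)%N].
Proof.
have /andP[z0 z1] := zeta01.
have ex : exists t, surv G t x0 <= zeta.
  have /cvgr_lt/(_ _ z0)[N _ hN] := surv_cvg0 irr x0 G0.
  by exists N; apply: ltW; apply: hN => /=.
case: (ex_minnP ex) => t st tmin; exists t; split => //; last first.
  case: t st {tmin} => // ; rewrite /surv taboo0 (negbTE x0G) => h.
  by have := lt_le_trans z1 h; rewrite ltxx.
have S_t : [set r : R | Pr [set w | (r%:E < tau x0 G w)%E] <= zeta] t%:R.
  by rewrite /= Pr_lt_tau// natrK.
have S_ge : lbound [set r : R | Pr [set w | (r%:E < tau x0 G w)%E] <= zeta] t%:R.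
  move=> r /=; have [r0|r0] := leP 0 r.
    rewrite Pr_lt_tau// => /tmin tr; have /andP[+ _] := truncn_itv r0.
    by apply: le_trans; rewrite ler_nat.
  rewrite (_ : [set w | _] = setT).
    by rewrite /Pr probability_setT /= => h; have := lt_le_trans z1 h; rewrite ltxx.
  apply/seteqP; split => // w _ /=; apply: (@lt_le_trans _ _ 0%E); first by rewrite lte_fin.
  by apply: le_ereal_inf_tmp => _ [i _ <-]; rewrite lee_fin.
apply/eqP; rewrite eq_le; apply/andP; split.
  by apply: ge_inf => //; exists t%:R.
by apply: lb_le_inf => //; exists t%:R.
Qed.

Lemma T_Q_gt0 : 0 < T_Q zeta x0 G.
Proof. by have [t [-> t0 _ _]] := T_Q_nat; rewrite ltr0n. Qed.

(** Markov's inequality: just before the quantile, survival still has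
    probability more than [zeta]. *)
Lemma T_Q_le_T_E : zeta * T_Q zeta x0 G <= T_E x0 G.
Proof.
have [[|t] [-> t0 _ tmin]] := T_Q_nat; first by [].
rewrite T_E_green; apply: le_trans (surv_markov irr t x0 G0).
rewrite mulrC ler_wpM2l// ltW// ltNge.
by apply/negP => /tmin; rewrite ltnn.
Qed.

(** By Markov's inequality for the entrance time, from every state [x0 |: G] is
    reached within [s], about [2 / (1 - zeta) * max_entry], except with
    probability [(1 - zeta) / 2]. Once at [x0], a further quantile suffices to
    reach [G] except with probability [zeta]. So [G] is reached within
    [s + T_Q] with probability at least [(1 - zeta) / 2] from every state, and
    the bound follows from [psum_surv_bound]. *)
Lemma T_E_le_T_Q :
  T_E x0 G <= 2 / (1 - zeta) * (T_Q zeta x0 G + 2 / (1 - zeta) * max_entry).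
Proof.
have [t [-> t0 st _]] := T_Q_nat; have /andP[z0 z1] := zeta01.
have c0 : 0 < 2 / (1 - zeta) by rewrite divr_gt0// subr_gt0.
have a1 := max_entry_ge1.
set r := 2 / (1 - zeta) * max_entry.
have r0 : 0 <= r by rewrite mulr_ge0 ?(ltW c0)// (le_trans ler01).
have /andP[sr rs] := truncn_itv r0; set s := Num.truncn r in sr rs.
have short x : surv D s x <= (1 - zeta) / 2.
  have h := le_trans (surv_markov irr s x D0) (green_le_max x).
  rewrite -(ler_pM2l (ltr0Sn R s)); apply: le_trans h _.
  have -> : max_entry = r * ((1 - zeta) / 2) by rewrite /r; field; rewrite subr_eq0 gt_eqF.
  by rewrite ler_wpM2r ?(ltW rs)// divr_ge0// subr_ge0 ltW.
have contr x : surv G (s + t.-1).+1 x <= (1 + zeta) / 2.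
  rewrite -addnS prednK//; apply: le_trans (surv_split x0 G s t x) _.
  by have := short x; lra.
have q1 : (1 + zeta) / 2 < 1 by lra.
rewrite T_E_green; apply: (green_le irr G0) => // N.
apply: le_trans (psum_surv_bound N x0 q1 contr) _.
rewrite -addnS prednK// natrD.
have -> : 1 - (1 + zeta) / 2 = (2 / (1 - zeta))^-1 by field; rewrite subr_eq0 gt_eqF.
by rewrite invrK mulrC ler_pM2l// addrC lerD2l.
Qed.

End Quantile.
End ReferencePair.

(** * The hypotheses along a sequence of chains *)

Section Sequences.
Variables (R : realType) (X : nat -> markov_chain R).
Variables (x0 : forall n, X n) (G : forall n, {set X n}).
Hypotheses (irr : forall n, irreducible (X n))
           (ref : forall n, reference_pair (x0 n) (G n)).

Arguments irr : clear implicits.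

Local Notation a := (fun n => max_entry (x0 n) (G n)).

(** If the entrance time exceeds [R_n] with probability at most 1/2 from every
    state, its mean is at most [2 R_n], which is negligible against [T n].
    Conversely take for [R_n] the geometric mean of [a n] and [T n]: it is
    negligible against [T n], and by Markov's inequality the entrance time
    exceeds it with probability at most [R_n / T n]. The divergence of [T] is
    automatic because [a n] is at least 1. *)
Lemma HpG_iff (T : nat -> R) : (forall n, 0 < T n) ->
  HpG x0 G T <-> (fun n => a n / T n) @ \oo --> (0 : R).
Proof.
move=> T0; have a1 n : 1 <= a n := max_entry_ge1 (irr n) (ref n).
have a0 n : 0 < a n by apply: lt_le_trans (a1 n).
have D0 n : x0 n |: G n != finset.set0 by apply/set0Pn; exists (x0 n); exact: setU11.
split=> [[_ [_ [r [Rn [r0 rcvg Rn0 RnT Prn]]]]]|aT].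
  apply: (@squeeze0 _ _ (fun n => Rn n / T n) 2) => //.
  have /cvgr_lt/(_ 2^-1) : r @ \oo --> (0 : R) by [].
  rewrite invr_gt0 ltr0n => /(_ isT); apply: filterS => n rn.
  rewrite divr_ge0 ?(ltW (a0 n)) ?(ltW (T0 n))//= mulrA ler_pM2r ?invr_gt0//.
  have sv x : surv (x0 n |: G n) (Num.truncn (Rn n)) x <= 2^-1.
    rewrite -Pr_lt_tau ?(ltW (Rn0 n))//; apply: le_trans (ltW rn).
    apply: le_trans (Prn n).
    exact: (@le_sup_fin _ _ setT (fun x =>
      Pr [set w | ((Rn n)%:E < tau x (x0 n |: G n)%SET w)%E])).
  have [z zD] := other_state (ref n).
  have /andP[mR _] := truncn_itv (ltW (Rn0 n)).
  (* [Rn n < 1] is excluded: a state outside the pair has not entered at time 0 *)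
  case: (Num.truncn (Rn n)) sv mR => [/(_ z)|m sv mR].
    by rewrite /surv taboo0 (negbTE zD) invf_ge1// lern1.
  apply: max_entry_le => [|x _]; first by rewrite mulr_ge0// ltW.
  apply: (green_le (irr n) (D0 n)) => // N.
  have h2 : 2^-1 < 1 :> R by rewrite invf_lt1// ltr1n.
  apply: le_trans (psum_surv_bound N x h2 sv) _.
  rewrite (_ : 1 - 2^-1 = 2^-1); last by field.
  by rewrite invrK mulrC ler_pM2l.
split=> //; split.
  apply/cvgryPge => A; have A0 : 0 < (Num.max A 1)^-1.
    by rewrite invr_gt0 lt_max ltr01 orbT.
  have /cvgr_lt/(_ _ A0) := aT; apply: filterS => n.
  rewrite ltr_pdivrMr// mulrC ltr_pdivlMr ?lt_max ?ltr01 ?orbT// => h.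
  apply: le_trans (ltW h); rewrite -[leLHS]mul1r.
  apply: (@le_trans _ _ (1 * Num.max A 1)); first by rewrite ler_pM2l// le_max lexx.
  by rewrite ler_wpM2r ?a1// le_max ler01 orbT.
pose e n := Num.sqrt (a n / T n).
have e0 n : 0 < e n by rewrite sqrtr_gt0 divr_gt0.
have ecvg : e @ \oo --> (0 : R).
  rewrite -(@sqrtr0 R); apply: (@cvg_comp _ _ _ (fun n => a n / T n) Num.sqrt _ _ _ aT).
  exact: sqrt_continuous.
exists e, (fun n => e n * T n); split=> //.
- by move=> n; rewrite mulr_gt0.
- rewrite /prec (_ : (fun n => _) = e)//.
  by apply/funext => n; rewrite mulfK// gt_eqF.
- move=> n; apply: (@sup_fin_le _ _ setT) => [|x _]; first by exists (x0 n).
  have R0 : 0 < e n * T n by rewrite mulr_gt0.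
  rewrite Pr_lt_tau ?(ltW R0)//; set m := Num.truncn _.
  have /andP[_ Rm] := truncn_itv (ltW R0); rewrite -/m in Rm.
  have h := le_trans (surv_markov (irr n) m x (D0 n)) (green_le_max _ _ x).
  rewrite -(ler_pM2l R0).
  apply: (@le_trans _ _ (m.+1%:R * surv (x0 n |: G n) m x)).
    by rewrite ler_wpM2r ?surv_ge0// ltW.
  apply: le_trans h _; rewrite mulrAC -expr2 sqr_sqrtr ?mulfVK ?gt_eqF//.
  by rewrite divr_ge0// ltW.
Qed.

Let TE0 n : 0 < T_E (x0 n) (G n).
Proof. exact: lt_le_trans (T_E_ge1 (irr n) (ref n)). Qed.

Let TLT0 n : 0 < T_LT (x0 n) (G n).
Proof. exact: lt_le_trans (T_LT_ge1 (irr n) (ref n)). Qed.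

Let a0 n : 0 < a n.
Proof. exact: lt_le_trans (max_entry_ge1 (irr n) (ref n)). Qed.

Lemma HpG_E_iff_HpB : HpG_E x0 G <-> HpB x0 G.
Proof.
rewrite /HpG_E HpG_iff// /HpB.
have -> : (fun n => rho_B (x0 n) (G n)) = (fun n => a n / T_E (x0 n) (G n)).
  by apply/funext => n; exact: rho_BE.
by [].
Qed.

Lemma HpA_HpG_LT : HpA x0 G -> HpG_LT x0 G.
Proof.
move=> hA; apply/HpG_iff => //; apply: (squeeze0 (K := 1)) hA.
apply: nearW => n; rewrite mul1r divr_ge0 ?(ltW (a0 n)) ?(ltW (TLT0 n))//=.
by rewrite ler_pdivrMr// max_entry_le_rho_A.
Qed.

Lemma HpG_LT_HpG_E : HpG_LT x0 G -> HpG_E x0 G.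
Proof.
move=> /HpG_iff-/(_ TLT0) h; apply/HpG_iff => //; apply: (squeeze0 (K := 1)) h.
apply: nearW => n; rewrite mul1r divr_ge0 ?(ltW (a0 n)) ?(ltW (TE0 n))//=.
by rewrite ler_pM2l// lef_pV2 ?posrE//; exact: T_LT_le_T_E.
Qed.

(** The two reference times are comparable: one comparison is [T_Q_le_T_E]; in
    the other, [T_E_le_T_Q], the term in [a n] is absorbed by the left-hand side
    once [a n] is negligible against [T_E]. *)
Lemma HpG_E_iff_HpG_zeta (zeta : R) : 0 < zeta < 1 ->
  HpG_E x0 G <-> HpG_zeta x0 G zeta.
Proof.
move=> z01; have /andP[z0 z1] := z01.
have TQ0 n : 0 < T_Q zeta (x0 n) (G n) := T_Q_gt0 (irr n) (ref n) z01.
rewrite /HpG_E /HpG_zeta !HpG_iff//; split => h.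
  pose c := 2 / (1 - zeta).
  have c0 : 0 < c by apply: mulr_gt0; rewrite ?ltr0n ?invr_gt0 ?subr_gt0.
  apply: (squeeze0 (K := 2 * c)) (h).
  have k0 : 0 < 2 * c ^+ 2 by rewrite mulr_gt0// exprn_gt0.
  have e0 : 0 < (2 * c ^+ 2)^-1 by rewrite invr_gt0.
  have /cvgr_lt/(_ _ e0) := h; apply: filterS => n.
  rewrite (ltr_pdivrMr _ _ (TE0 n)) mulrC (ltr_pdivlMr _ _ k0) => an.
  rewrite divr_ge0 ?(ltW (a0 n)) ?(ltW (TQ0 n))//= ler_pdivrMr//.
  rewrite mulrA mulrAC ler_pdivlMr// mulrAC -[_ * _ * a n]mulrC ler_pM2l//.
  have := T_E_le_T_Q (irr n) (ref n) z01; rewrite -/c => hE.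
  move: an hE; set A := max_entry _ _; set TE := T_E _ _; set TQ := T_Q _ _ _.
  nra.
apply: (squeeze0 (K := zeta^-1)) h.
apply: nearW => n; rewrite divr_ge0 ?(ltW (a0 n)) ?(ltW (TE0 n))//=.
rewrite mulrCA ler_pM2l// -invfM lef_pV2 ?posrE ?mulr_gt0//.
exact: T_Q_le_T_E.
Qed.

End Sequences.

(** * Realisation of a stochastic matrix *)

Section Construction.
Variables (R : realType) (T : finType) (p : T -> T -> R).
Hypotheses (p0 : forall x y, 0 <= p x y) (p1 : forall x, \sum_y p x y = 1).
Implicit Types (x y z : T) (w A P : R) (k n t : nat).

(** The unit interval is cut, following the enumeration of [T], into
    consecutive intervals of lengths [p x y]. *)
Definition cumul x k : R := \sum_(y <- take k (enum T)) p x y.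

Definition lo x y : R := cumul x (index y (enum T)).
Definition hi x y : R := cumul x (index y (enum T)).+1.

Lemma cumul_nd x k n : (k <= n)%N -> cumul x k <= cumul x n.
Proof.
move=> kn; rewrite /cumul -(cat_take_drop k (take n (enum T))) take_takel//.
by rewrite big_cat/= lerDl sumr_ge0.
Qed.

Lemma cumul0 x : cumul x 0 = 0.
Proof. by rewrite /cumul take0 big_nil. Qed.

Lemma cumul1 x : cumul x #|T| = 1.
Proof. by rewrite /cumul cardE take_size big_enum. Qed.

Lemma hiE x y : hi x y = lo x y + p x y.
Proof.
have ys : (index y (enum T) < size (enum T))%N by rewrite index_mem mem_enum.
rewrite /hi /lo /cumul (take_nth y ys) nth_index ?mem_enum//.
by rewrite -cats1 big_cat big_seq1.
Qed.

Lemma lo_ge0 x y : 0 <= lo x y.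
Proof. by rewrite -(cumul0 x); exact: cumul_nd. Qed.

Lemma hi_le1 x y : hi x y <= 1.
Proof.
rewrite -(cumul1 x); apply: cumul_nd; rewrite cardE index_mem.
by rewrite mem_enum.
Qed.

Definition inside w A P x y : bool := A + P * lo x y <= w < A + P * hi x y.

Lemma inside_uniq w A P x y y' : 0 <= P ->
  inside w A P x y -> inside w A P x y' -> y = y'.
Proof.
move=> P0.
have lt_absurd u v : (index u (enum T) < index v (enum T))%N ->
    inside w A P x u -> inside w A P x v -> False.
  move=> uv /andP[_ h1] /andP[h2 _].
  have : A + P * hi x u <= A + P * lo x v by rewrite lerD2l ler_wpM2l// cumul_nd.
  by move=> /(lt_le_trans h1)/lt_le_trans/(_ h2); rewrite ltxx.
move=> iy iy'; case: (ltngtP (index y (enum T)) (index y' (enum T))) => h.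
- by case: (lt_absurd _ _ h iy iy').
- by case: (lt_absurd _ _ h iy' iy).
- by rewrite -(nth_index y (mem_enum T y)) h nth_index// mem_enum.
Qed.

Lemma inside_ex w A P x : A <= w < A + P -> exists y, inside w A P x y.
Proof.
move=> /andP[Aw wP].
have : forall n, (n <= #|T|)%N -> w < A + P * cumul x n -> exists y, inside w A P x y.
  elim=> [_|n IH nT wn].
    by rewrite cumul0 mulr0 addr0 ltNge Aw.
  (* either [w] lies in the [n]-th interval or it lies further left *)
  have [h|h] := leP (A + P * cumul x n) w; last by apply: IH => //; exact: ltnW.
  have [y0 _] : exists y0 : T, True.
    by case: (pickP T) => [y|e]; [exists y|move: nT; rewrite (eq_card0 e)].
  rewrite cardE in nT; exists (nth y0 (enum T) n).
  by rewrite /inside /lo /hi index_uniq ?enum_uniq// h wn.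
by apply; [exact: leqnn|rewrite cumul1 mulr1].
Qed.

(** One step of the chain driven by the single uniform variable [w]: the current
    state comes with the interval [[A, A + P[] of all the values of [w] that
    lead to the same past, and [w] chooses the next state by its position in
    the subdivision of that interval. For [w] outside the interval the chain
    stays put, which makes it total and measurable on the whole line. *)
Definition subdivide w (o : T * R * R) : T * R * R :=
  let: (x, A, P) := o in
  if [pick y | inside w A P x y] is Some y
  then (y, A + P * lo x y, P * p x y) else o.

Arguments subdivide : simpl never.

Lemma subdivideE w A P x y : 0 <= P -> inside w A P x y ->
  subdivide w (x, A, P) = (y, A + P * lo x y, P * p x y).
Proof.
move=> P0 iy; rewrite /subdivide; case: pickP => [y' iy'|/(_ y)]; last by rewrite iy.
by rewrite (inside_uniq P0 iy' iy).
Qed.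

Definition path_of x t w : T := (iter t (subdivide w) (x, 0, 1)).1.1.

Lemma measurable_inside A P x y : measurable [set w : R | inside w A P x y].
Proof.
rewrite (_ : [set w : R | _] = `[A + P * lo x y, A + P * hi x y[%classic).
  exact: measurable_itv.
by apply/seteqP; split => w /=; rewrite in_itv.
Qed.

Lemma measurable_run t (o : T * R * R) y : 0 <= o.2 ->
  measurable [set w : R | (iter t (subdivide w) o).1.1 = y].
Proof.
elim: t o => [|t IH] [[x A] P] /= P0.
  have [->|xy] := eqVneq x y.
    by rewrite (_ : [set _ | _] = setT)//; apply/seteqP; split.
  rewrite (_ : [set _ | _] = set0)//; apply/seteqP; split => // w /= /eqP.
  by rewrite (negbTE xy).
(* The first step is decided by the interval [I z] that contains [w]; if there
   is none the chain stays put. *)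
pose next z : T * R * R := (z, A + P * lo x z, P * p x z).
pose I z := [set w : R | inside w A P x z].
have mI z : measurable (I z) by exact: measurable_inside.
rewrite (_ : [set _ | _] =
  (\bigcup_(z in [set: T])
     (I z `&` [set w | (iter t (subdivide w) (next z)).1.1 = y])) `|`
  ((~` \bigcup_(z in [set: T]) I z) `&`
     [set w | (iter t (subdivide w) (x, A, P)).1.1 = y])); last first.
  apply/seteqP; split => w.
    rewrite /= -iterS iterSr => e.
    have [[z iz]|ni] := pselect (exists z, inside w A P x z).
      left; exists z => //; split => //=.
      by rewrite -e /next -(subdivideE P0 iz).
    right; split; first by move=> [z _ iz]; apply: ni; exists z.
    rewrite /= -e /subdivide; case: pickP => // z iz.
    by case: ni; exists z.
  rewrite /= -iterS iterSr => -[[z _ [iz /= <-]]|[ni /= <-]].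
    by rewrite (subdivideE P0 iz).
  rewrite {2}/subdivide; case: pickP => // z iz.
  by case: ni; exists z.
apply: measurableU.
  apply: fin_bigcup_measurable => // z _; apply: measurableI => //.
  by apply: IH; rewrite /= mulr_ge0.
apply: measurableI; last exact: IH.
by apply: measurableC; apply: fin_bigcup_measurable.
Qed.

(** Left end point and length of the interval of the [w] for which the
    trajectory follows [s] up to time [t]; the length is the product of the
    transition probabilities along [s]. *)
Fixpoint box (s : nat -> T) t : R * R :=
  if t is t'.+1 then
    ((box s t').1 + (box s t').2 * lo (s t') (s t),
     (box s t').2 * p (s t') (s t))
  else (0, 1).

Definition in_box s t w : bool := (box s t).1 <= w < (box s t).1 + (box s t).2.

Lemma box_ge0 s t : 0 <= (box s t).2.
Proof. by elim: t => [|t IH] //=; rewrite mulr_ge0. Qed.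

Lemma in_boxS s t w :
  in_box s t.+1 w = inside w (box s t).1 (box s t).2 (s t) (s t.+1).
Proof. by rewrite /in_box /inside /= hiE mulrDr addrA. Qed.

Lemma box_nested s t :
  (box s t).1 <= (box s t.+1).1 /\
  (box s t.+1).1 + (box s t.+1).2 <= (box s t).1 + (box s t).2.
Proof.
rewrite /= -addrA -mulrDr -hiE; split.
  by rewrite lerDl mulr_ge0 ?box_ge0 ?lo_ge0.
by rewrite lerD2l -[leRHS]mulr1 ler_wpM2l ?box_ge0 ?hi_le1.
Qed.

Lemma in_box_le s i t w : (i <= t)%N -> in_box s t w -> in_box s i w.
Proof.
elim: t => [|t IH]; first by rewrite leqn0 => /eqP ->.
rewrite leq_eqVlt => /orP[/eqP ->//|it] /andP[l1 l2].
apply: IH => //; have [n1 n2] := box_nested s t.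
by apply/andP; split; [exact: le_trans l1|exact: lt_le_trans n2].
Qed.

Lemma box_unit s t : 0 <= (box s t).1 /\ (box s t).1 + (box s t).2 <= 1.
Proof.
elim: t => [|t [h1 h2]]; first by rewrite /= add0r.
have [n1 n2] := box_nested s t.
by split; [exact: le_trans n1|exact: le_trans h2].
Qed.

Lemma run_in_box s t w : in_box s t w ->
  iter t (subdivide w) (s 0%N, 0, 1) = (s t, (box s t).1, (box s t).2).
Proof.
elim: t => [//|t IH] h; rewrite iterS IH ?(in_box_le _ h)//.
by rewrite in_boxS in h; rewrite (subdivideE (box_ge0 s t) h).
Qed.

Lemma path_ofP x t (s : nat -> T) w : 0 <= w < 1 ->
  (forall i, (i <= t)%N -> path_of x i w = s i) <-> s 0%N = x /\ in_box s t w.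
Proof.
move=> w01; split=> [e|[<- h] i it]; last first.
  by rewrite /path_of (run_in_box (in_box_le it h)).
have s0 : s 0%N = x by rewrite -(e 0%N).
split=> //; elim: t e => [|t IH] e; first by rewrite /in_box /= add0r.
have h : in_box s t w by apply: IH => i it; rewrite e// leqW.
have [y iy] := @inside_ex w (box s t).1 (box s t).2 (s t) h.
have := e t.+1 (leqnn _); rewrite /path_of iterS -s0 (run_in_box h).
by rewrite (subdivideE (box_ge0 s t) iy) /= => ys; rewrite in_boxS -ys.
Qed.

Let U : probability (measurableTypeR R) R := uniform_prob (@ltr01 R).

Lemma uniform_itv A P : 0 <= A -> 0 <= P -> A + P <= 1 ->
  U `[A, A + P[%classic = P%:E.
Proof.
move=> A0 P0 AP1; rewrite /U /= /uniform_prob.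
rewrite (eq_integral (fun=> 1%E)); last first.
  move=> w; rewrite inE /= in_itv /= => /andP[Aw wP].
  rewrite /uniform_pdf (le_trans A0 Aw) (le_trans (ltW wP) AP1) /=.
  by rewrite subr0 invr1.
rewrite integral_cst//= mul1e lebesgue_measure_itv /= lte_fin ltrDl.
case: ltgtP P0 => // [P0 _|<- _] //.
by rewrite -EFinD addrAC subrr add0r.
Qed.

Lemma uniform_unit (E : set R) : measurable E -> U E = U (E `&` `[0, 1[%classic).
Proof.
move=> mE; set I : set R := `[0, 1[%classic.
have mI : measurable I by exact: measurable_itv.
have U1 : U I = 1%E.
  by have := @uniform_itv 0 1; rewrite !add0r; apply.
have U0 : U (~` I) = 0%E by rewrite probability_setC// U1 subee.
transitivity (U (E `\` I) + U (E `&` I))%E; first exact: measureDI.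
rewrite [X in (X + _)%E](_ : _ = 0%E) ?add0e//.
apply: (@subset_measure0 _ _ _ U _ (~` I)) => //.
- exact: measurableD.
- exact: measurableC.
Qed.

Lemma path_of_measurable x t y : measurable (path_of x t @^-1` [set y] : set R).
Proof. exact: (@measurable_run t (x, 0, 1)). Qed.

Lemma path_of_law x t s :
  U [set w | forall i, (i <= t)%N -> path_of x i w = s i] =
  (if s 0%N == x then (box s t).2 else 0)%:E.
Proof.
have mE : measurable ([set w | forall i, (i <= t)%N -> path_of x i w = s i] : set R).
  rewrite (_ : [set w | _] =
    \bigcap_(i in `I_t.+1) (path_of x i @^-1` [set s i])); last first.
    by apply/seteqP; split => w h i; apply: h.
  by apply: fin_bigcap_measurable => // i _; exact: path_of_measurable.
rewrite uniform_unit//; case: eqP => s0; last first.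
  rewrite (_ : _ `&` _ = set0) ?measure0//; apply/seteqP; split => // w [/= h].
  by rewrite in_itv /= => /path_ofP - /(_ x t s)[/(_ h)[]].
have [b1 b2] := box_unit s t.
rewrite -(uniform_itv b1 (box_ge0 s t) b2); congr (U _).
apply/seteqP; split => w /=; rewrite !in_itv /=.
  by move=> [h /path_ofP - /(_ x t s)[/(_ h)[]]].
move=> h; have w01 : 0 <= w < 1.
  by case/andP: h => h1 h2; rewrite (le_trans b1 h1) (lt_le_trans h2 b2).
by split => //; apply/(path_ofP _ _ _ w01).
Qed.

Lemma path_of_start x : U [set w | path_of x 0 w = x] = 1%E.
Proof. by rewrite (_ : [set w | _] = setT) ?probability_setT//; apply/seteqP; split. Qed.

Lemma path_of_markov x t (s : nat -> T) :
  U [set w | forall i, (i <= t.+1)%N -> path_of x i w = s i] =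
  (U [set w | forall i, (i <= t)%N -> path_of x i w = s i] *
     (p (s t) (s t.+1))%:E)%E.
Proof. by rewrite !path_of_law -EFinM /=; case: ifP => //; rewrite mul0r. Qed.

Definition chain_of : markov_chain R :=
  @MarkovChain R T p p0 p1 _ (measurableTypeR R) U path_of
    path_of_measurable path_of_start path_of_markov.

End Construction.

(** * Counterexamples *)

Section Reach.
Variables (R : realType) (C : markov_chain R).
Implicit Types x y z : C.

Lemma trans_iter_ge0 t x y : 0 <= trans_iter t x y.
Proof.
by elim: t x => [|t IH] x /=; [exact: ler0n|exact: mean_ge0].
Qed.

Definition reaches x y := exists t, 0 < trans_iter t x y.

Lemma reaches_refl x : reaches x x.
Proof. by exists 0%N; rewrite /= eqxx. Qed.

Lemma reaches_step x y z : 0 < mc_trans x y -> reaches y z -> reaches x z.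
Proof.
move=> xy [t yz]; exists t.+1 => /=.
rewrite (bigD1 y)//= ltr_wpDr ?mulr_gt0//; apply: sumr_ge0 => u _.
by rewrite mulr_ge0 ?mc_trans_ge0 ?trans_iter_ge0.
Qed.

End Reach.

Section Star.
Variables (R : realType) (n : nat).

Local Notation M := n.+3.

(** From the centre [ord0] the chain jumps to a uniform state, from any other
    state back to the centre. With [G] a single leaf, every entrance takes one
    step while the centre is visited [M] times on average, but the number [M]
    of states is as large as the inverse escape probability. *)
Definition star_trans (x y : 'I_M) : R := if x == ord0 then M%:R^-1 else (y == ord0)%:R.

Lemma star_trans_ge0 x y : 0 <= star_trans x y.
Proof. by rewrite /star_trans; case: ifP; rewrite ?invr_ge0 ler0n. Qed.

Lemma star_trans_sum1 x : \sum_y star_trans x y = 1.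
Proof.
rewrite /star_trans; case: (x == ord0).
  by rewrite sumr_const card_ord -[LHS]mulr_natr mulVf// pnatr_eq0.
by rewrite (bigD1 ord0)//= big1 ?addr0// => y /negbTE ->.
Qed.

Definition star : markov_chain R := chain_of star_trans_ge0 star_trans_sum1.

Definition star_x0 : star := ord0 : 'I_M.
Definition star_g : star := inord 1 : 'I_M.
Definition star_G : {set star} := [set star_g]%SET.

Lemma star_g_neq0 : star_g != star_x0.
Proof. by apply/eqP => /(congr1 (@nat_of_ord M)); rewrite inordK. Qed.

Lemma star_irreducible : irreducible star.
Proof.
have r0 y : reaches star_x0 y.
  apply: (@reaches_step _ star _ y); last exact: reaches_refl.
  by rewrite /= /star_trans eqxx invr_gt0 ltr0n.
move=> x y; have [->|x0] := eqVneq x star_x0; first exact: r0.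
apply: (@reaches_step _ star x star_x0 y _ (r0 y)).
by rewrite /= /star_trans (negbTE x0) eqxx ltr01.
Qed.

Lemma star_reference : reference_pair star_x0 star_G.
Proof.
split.
- by apply/set0Pn; exists star_g; rewrite finset.in_set1.
- by rewrite finset.in_set1 eq_sym star_g_neq0.
- apply/set0Pn; exists (inord 2 : 'I_M).
  rewrite finset.in_setC in_setU1 finset.in_set1 negb_or.
  by apply/andP; split; apply/eqP => /(congr1 (@nat_of_ord M)); rewrite !inordK.
Qed.

Lemma star_max_entry : max_entry star_x0 star_G <= 1.
Proof.
have D0 : star_x0 |: star_G != finset.set0 by apply/set0Pn; exists star_x0; exact: setU11.
apply: max_entry_le => // x xD.
rewrite (green_step star_irreducible D0 _ xD)// (bigD1 star_x0)//=.
rewrite (greenF _ (setU11 _ _)) mulr0 add0r big1 ?addr0// => y /negbTE y0.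
have x0 : x == ord0 = false by apply: contraNF xD => /eqP ->; exact: setU11.
by rewrite /star_trans x0 y0 mul0r.
Qed.

Lemma star_T_LT : T_LT star_x0 star_G = M%:R.
Proof.
rewrite (T_LT_green star_irreducible star_reference).
have [G0 x0G _] := star_reference; set h := green _ _.
have f0 (y : star) : 0 <= (y == star_x0)%:R :> R by exact: ler0n.
have hg : h star_g = 0 by apply: greenF; rewrite finset.in_set1.
have hE y : y != star_g -> h y = h star_x0.
  move=> yg; have [->//|y0] := eqVneq y star_x0.
  have yG : y \notin star_G by rewrite finset.in_set1.
  rewrite {1}/h (green_step star_irreducible G0 f0 yG) (negbTE y0) add0r.
  rewrite (bigD1 star_x0)//= /star_trans (negbTE y0) eqxx mul1r big1 ?addr0//.
  by move=> u /negbTE u0; rewrite [u == _]u0 mul0r.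
have e0 : h star_x0 = 1 + M%:R^-1 * (h star_x0 * n.+2%:R).
  rewrite {1}/h (green_step star_irreducible G0 f0 x0G) eqxx; congr (_ + _).
  rewrite (bigD1 star_g)//= -/h hg mulr0 add0r.
  rewrite (eq_bigr (fun=> M%:R^-1 * h star_x0)); last first.
    by move=> y yg; rewrite hE// /star_trans eqxx.
  rewrite sumr_const -[LHS]mulr_natr mulrA; congr (_ * _%:R).
  by rewrite cardC1 card_ord.
have M0 : M%:R != 0 :> R by rewrite pnatr_eq0.
have : M%:R * h star_x0 = M%:R + h star_x0 * n.+2%:R.
  by rewrite {1}e0 mulrDr mulr1 mulVKf.
by rewrite -[M]addn1 natrD mulrDl mul1r mulrC => H; lra.
Qed.

Lemma star_no_HpA : 1 <= #|star|%:R * rho_A star_x0 star_G.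
Proof.
have := inv_T_LT_le_rho_A star_irreducible star_reference.
rewrite star_T_LT; have -> : #|star| = M by rewrite card_ord.
by move=> h; rewrite mulrC -ler_pdivrMr ?ltr0n// mul1r.
Qed.

End Star.

Section Trap.
Variables (R : realType) (n : nat).

Let e : R := n.+2%:R^-1.

Let e_gt0 : 0 < e. Proof. by rewrite invr_gt0 ltr0n. Qed.
Let e_lt1 : e < 1. Proof. by rewrite invf_lt1 ?ltr0n// ltr1n. Qed.

(** State 0 is [x0], state 2 is [G], and state 1 is a trap that is left with
    probability [e], almost always towards [x0]. Leaving the trap takes time
    [1 / e] and about [1 / e] excursions are needed before [G] is hit: [T_E] is of
    order [1 / e ^+ 2], but [x0] is visited only [1 / e] times, no more than
    the number of steps of a single stay in the trap. *)
Definition trap_trans (x y : 'I_3) : R :=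
  match val x, val y with
  | 0%N, 1%N => 1
  | 1%N, 0%N => e * (1 - e)
  | 1%N, 1%N => 1 - e
  | 1%N, 2%N => e ^+ 2
  | 2%N, 0%N => 1
  | _, _ => 0
  end.

Let s0 : 'I_3 := @Ordinal 3 0 isT.
Let s1 : 'I_3 := @Ordinal 3 1 isT.
Let s2 : 'I_3 := @Ordinal 3 2 isT.

Lemma ord3P (x : 'I_3) : [\/ x = s0, x = s1 | x = s2].
Proof.
by case: x => [[|[|[|]]]] // i; [constructor 1|constructor 2|constructor 3];
  apply: val_inj.
Qed.

Lemma sum_ord3 (f : 'I_3 -> R) : \sum_y f y = f s0 + f s1 + f s2.
Proof.
rewrite !big_ord_recl big_ord0 addr0 addrA.
by congr (f _ + f _ + f _); apply: val_inj.
Qed.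

Lemma trap_trans_ge0 x y : 0 <= trap_trans x y.
Proof.
have e1 := e_lt1; have e0 := e_gt0.
by case: (ord3P x) => ->; case: (ord3P y) => ->; rewrite /trap_trans /=; nra.
Qed.

Lemma trap_trans_sum1 x : \sum_y trap_trans x y = 1.
Proof.
by rewrite sum_ord3; case: (ord3P x) => ->; rewrite /trap_trans /=; ring.
Qed.

Definition trap : markov_chain R := chain_of trap_trans_ge0 trap_trans_sum1.

Definition trap_x0 : trap := s0.
Definition trap_z : trap := s1.
Definition trap_g : trap := s2.
Definition trap_G : {set trap} := [set trap_g]%SET.

Lemma trap_irreducible : irreducible trap.
Proof.
have e1 := e_lt1; have e0 := e_gt0.
have rz y : reaches trap_z y.
  apply: (@reaches_step _ trap _ y); last exact: reaches_refl.
  by rewrite /= /trap_trans; case: (ord3P y) => -> /=; nra.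
have r0 y : reaches trap_x0 y.
  by apply: (@reaches_step _ trap _ trap_z _ _ (rz y)); exact: ltr01.
have rg y : reaches trap_g y.
  by apply: (@reaches_step _ trap _ trap_x0 _ _ (r0 y)); exact: ltr01.
by move=> x y; case: (ord3P x) => ->; [exact: r0|exact: rz|exact: rg].
Qed.

Lemma trap_reference : reference_pair trap_x0 trap_G.
Proof.
split.
- by apply/set0Pn; exists trap_g; rewrite finset.in_set1.
- by rewrite finset.in_set1.
- by apply/set0Pn; exists trap_z; rewrite finset.in_setC in_setU1 finset.in_set1.
Qed.

Lemma trap_step (F : {set trap}) (f : trap -> R) x : F != finset.set0 ->
  (forall y, 0 <= f y) -> x \notin F ->
  green F f x = f x + (trap_trans x s0 * green F f trap_x0 +
     trap_trans x s1 * green F f trap_z + trap_trans x s2 * green F f trap_g).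
Proof.
by move=> F0 f0 xF; rewrite {1}(green_step trap_irreducible F0 f0 xF) sum_ord3.
Qed.

Lemma trap_max_entry : max_entry trap_x0 trap_G = n.+2%:R.
Proof.
set D := trap_x0 |: trap_G.
have D0 : D != finset.set0 by apply/set0Pn; exists trap_x0; exact: setU11.
have zD : trap_z \notin D by rewrite in_setU1 finset.in_set1.
have gD : trap_g \in D by rewrite in_setU1 finset.in_set1 eqxx orbT.
have hz : green D (fun=> 1) trap_z = n.+2%:R.
  have := trap_step D0 (fun=> ler01) zD.
  rewrite (greenF _ (setU11 _ _)) (greenF _ gD) /trap_trans /= => E.
  have := e_gt0; have eN : e * n.+2%:R = 1 by rewrite mulVf// pnatr_eq0.
  move: E eN; set g := green _ _ _; set N := n.+2%:R => E eN e0.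
  have E1 : e * g = e * N by lra.
  by apply: (mulfI _ E1); rewrite gt_eqF.
apply/eqP; rewrite eq_le -{2}hz green_le_max andbT.
apply: max_entry_le => // x xD; rewrite -hz.
case: (ord3P x) xD => -> //; first by rewrite setU11.
by rewrite gD.
Qed.

Lemma trap_T_LT : T_LT trap_x0 trap_G = n.+2%:R.
Proof.
rewrite (T_LT_green trap_irreducible trap_reference).
have [G0 x0G _] := trap_reference.
have zG : trap_z \notin trap_G by rewrite finset.in_set1.
have gG : trap_g \in trap_G by rewrite finset.in_set1.
have f0 (y : trap) : 0 <= (y == trap_x0)%:R :> R by exact: ler0n.
have := trap_step G0 f0 x0G; have := trap_step G0 f0 zG.
rewrite (greenF _ gG) /trap_trans /= => E1 E0.
have := e_gt0; have eN : e * n.+2%:R = 1 by rewrite mulVf// pnatr_eq0.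
move: E1 E0 eN; set g := green _ _ trap_x0; set k := green _ _ _; set N := n.+2%:R.
move=> E1 E0 eN e0.
have E2 : e * k = e * ((1 - e) * g) by lra.
have {}E2 : k = (1 - e) * g by apply: (mulfI _ E2); rewrite gt_eqF.
have E3 : e * g = e * N by lra.
by apply: (mulfI _ E3); rewrite gt_eqF.
Qed.

Lemma trap_T_E : n.+2%:R ^+ 2 <= T_E trap_x0 trap_G.
Proof.
rewrite (T_E_green trap_irreducible trap_reference).
have [G0 x0G _] := trap_reference.
have zG : trap_z \notin trap_G by rewrite finset.in_set1.
have gG : trap_g \in trap_G by rewrite finset.in_set1.
have := trap_step G0 (fun=> ler01) x0G; have := trap_step G0 (fun=> ler01) zG.
rewrite (greenF _ gG) /trap_trans /= => E1 E0.
have := e_gt0; have := e_lt1.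
have eN : e * n.+2%:R = 1 by rewrite mulVf// pnatr_eq0.
move: E1 E0 eN; set g := green _ _ trap_x0; set k := green _ _ _; set N := n.+2%:R.
move=> E1 E0 eN e1 e0.
have Eg : g = 1 + k by lra.
have E2 : e ^+ 2 * k = 1 + e * (1 - e) by move: E1; rewrite Eg; lra.
rewrite -(@ler_pM2l _ (e ^+ 2)) ?exprn_gt0// -exprMn eN expr1n Eg mulrDr E2.
by nra.
Qed.

End Trap.

Section Counterexamples.
Variable R : realType.

Lemma star_HpG_LT : HpG_LT (fun n => star_x0 R n) (fun n => star_G R n).
Proof.
have irr n := @star_irreducible R n; have ref n := @star_reference R n.
apply/(HpG_iff irr ref) => [n|].
  by apply: lt_le_trans (T_LT_ge1 (irr n) (ref n)).
apply: (squeeze0 (K := 1)) (@cvg_harmonic R); apply: nearW => n.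
have a0 := le_trans ler01 (max_entry_ge1 (irr n) (ref n)).
rewrite star_T_LT divr_ge0//= mul1r /harmonic /=.
rewrite ler_pdivrMr ?ltr0n//; apply: le_trans (star_max_entry R n) _.
by rewrite ler_pdivlMl ?ltr0n// mulr1 ler_nat ltnW.
Qed.

Lemma star_not_HpA : ~ HpA (fun n => star_x0 R n) (fun n => star_G R n).
Proof.
move=> /cvgr_lt/(_ 1 ltr01)[N _ /(_ N (leqnn N))].
by rewrite ltNge star_no_HpA.
Qed.

Lemma trap_HpG_E : HpG_E (fun n => trap_x0 R n) (fun n => trap_G R n).
Proof.
have irr n := @trap_irreducible R n; have ref n := @trap_reference R n.
have T0 n := lt_le_trans ltr01 (T_E_ge1 (irr n) (ref n)).
apply/(HpG_iff irr ref T0).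
apply: (squeeze0 (K := 1)) (@cvg_harmonic R); apply: nearW => n.
rewrite trap_max_entry divr_ge0 ?(ltW (T0 n))//= mul1r /harmonic /=.
rewrite ler_pdivrMr// ler_pdivlMl ?ltr0n//; apply: le_trans (trap_T_E R n).
by rewrite expr2 ler_wpM2r// ler_nat.
Qed.

Lemma trap_not_HpG_LT : ~ HpG_LT (fun n => trap_x0 R n) (fun n => trap_G R n).
Proof.
have irr n := @trap_irreducible R n; have ref n := @trap_reference R n.
have T0 n := lt_le_trans ltr01 (T_LT_ge1 (irr n) (ref n)).
move=> /(HpG_iff irr ref T0)/cvgr_lt/(_ 1 ltr01)[N _ /(_ N (leqnn N))] /=.
by rewrite trap_max_entry trap_T_LT divff ?ltxx// pnatr_eq0.
Qed.

End Counterexamples.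

Theorem theorem2p17 (R : realType) :
  (forall (X : nat -> markov_chain R)
          (x0 : forall n, X n) (G : forall n, {set X n}),
     (forall n, irreducible (X n)) ->
     (forall n, reference_pair (x0 n) (G n)) ->
     forall zeta : R, 0 < zeta < 1 ->
       [/\ HpA x0 G -> HpG_LT x0 G,
           HpG_LT x0 G -> HpG_E x0 G,
           HpG_E x0 G <-> HpG_zeta x0 G zeta
         & HpG_zeta x0 G zeta <-> HpB x0 G]) /\
  (exists (X : nat -> markov_chain R)
          (x0 : forall n, X n) (G : forall n, {set X n}),
     [/\ forall n, irreducible (X n),
         forall n, reference_pair (x0 n) (G n),
         HpG_LT x0 G
       & ~ HpA x0 G]) /\
  (exists (X : nat -> markov_chain R)
          (x0 : forall n, X n) (G : forall n, {set X n}),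
     [/\ forall n, irreducible (X n),
         forall n, reference_pair (x0 n) (G n),
         HpG_E x0 G
       & ~ HpG_LT x0 G]).
Proof.
split; last split.
- move=> X x0 G irr ref zeta z01; split.
  + exact: HpA_HpG_LT.
  + exact: HpG_LT_HpG_E.
  + exact: HpG_E_iff_HpG_zeta.
  + rewrite -(HpG_E_iff_HpG_zeta irr ref z01); exact: HpG_E_iff_HpB.
- exists (fun n => star R n), (fun n => star_x0 R n), (fun n => star_G R n); split.
  + by move=> n; exact: star_irreducible.
  + by move=> n; exact: star_reference.
  + exact: star_HpG_LT.
  + exact: star_not_HpA.
- exists (fun n => trap R n), (fun n => trap_x0 R n), (fun n => trap_G R n); split.
  + by move=> n; exact: trap_irreducible.
  + by move=> n; exact: trap_reference.
  + exact: trap_HpG_E.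
  + exact: trap_not_HpG_LT.
Qed.
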